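(* For every $1<q<p<\infty$ and every integer $k>1$, there exists a reflexive Banach space $X$ with an unconditional basis such that $X$ admits $\ell^q$ as a spreading model of order $k$, while for every $l\in\mathbb{N}$, every $l$-iterated spreading model of $X$ is equivalent either to the usual basis of $\ell^1$ or to the usual basis of $\ell^p$.
   Context: $\mathbb{N}=\{1,2,\dots\}$. For $M\subseteq\mathbb{N}$ infinite, $M(k)$ is its $k$-th element; for a finite set $s$, $s(k)$ is its $k$-th element; $t\sqsubseteq s$ means initial segment. For a family $\mathcal{F}$ of finite subsets of $\mathbb{N}$ let $\widehat{\mathcal{F}}=\{t:\exists s\in\mathcal{F},\ t\sqsubseteq s\}$ and $\mathcal{F}\upharpoonright M=\{s\in\mathcal{F}:s\subseteq M\}$. $\mathcal{F}$ is thin if no element is a proper initial segment of another. A family is regular if it is hereditary (closed under subsets), spreading (if $\{n_1<\dots<n_k\}$ is in it, $m_1<\dots<m_k$, $n_i\le m_i$ for all $i$, then $\{m_1,\dots,m_k\}$ is in it) and compact (its characteristic functions form a closed subset of $\{0,1\}^{\mathbb{N}}$). $\mathcal{F}$ is regular thin if it is thin and $\widehat{\mathcal{F}}$ is regular. The order $o(\mathcal{F})$ is the (countable) rank of the well-founded tree $\widehat{\mathcal{F}}$: maximal elements have rank $0$, the rank of $s$ is $\sup\{\mathrm{rank}(t)+1: t\in\widehat{\mathcal{F}},\ s\sqsubset t\}$, and $o(\mathcal{F})$ is the rank of $\emptyset$. (E.g. the family of all $k$-element subsets of $\mathbb{N}$ has order $k$.) A tuple $(s_1,\dots,s_l)$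 of nonempty finite subsets of $\mathbb{N}$ is plegma if $s_i(k)<s_j(k)$ whenever $i<j$ and $k\le\min(|s_i|,|s_j|)$, and $s_i(k)<s_j(k+1)$ for all $i,j$ and $k\le\min(|s_i|,|s_j|-1)$. An $\mathcal{F}$-subsequence $(x_s)_{s\in\mathcal{F}\upharpoonright M}$ in a Banach space $X$ ($M\subseteq\mathbb{N}$ infinite) is a map $s\mapsto x_s$ from $\mathcal{F}\upharpoonright M$ to $X$. Let $(e_n)_n$ be a Hamel basis of an infinite-dimensional seminormed space with seminorm $\|\cdot\|_*$. $(x_s)_{s\in\mathcal{F}\upharpoonright M}$ generates $(e_n)_n$ as an $\mathcal{F}$-spreading model if there is a null sequence $(\delta_n)_n$ of positive reals such that $\big|\,\|\sum_{j=1}^k a_jx_{s_j}\|-\|\sum_{j=1}^k a_je_j\|_*\big|\le\delta_l$ for all $1\le k\le l$, all plegma $k$-tuples $(s_j)_{j=1}^k$ in $\mathcal{F}\upharpoonright M$ with $s_1(1)\ge M(l)$ and all $a_1,\dots,a_k\in[-1,1]$. $X$ admits $\ell^q$ as a spreading model of order $\xi$ if some $\mathcal{F}$-subsequence in $X$, with $\mathcal{F}$ regular thin and $o(\mathcal{F})=\xi$, generates a sequence $(e_n)_n$ equivalent to the usual basis of $\ell^q$. Iterated spreading models. A sequence $(e_n)_n$ is a (classical) spreading model of a sequence $(x_n)_n$ in a Banach space if some subsequence $(y_n)_n$ of $(x_n)_n$ generates it, i.e. there is a null sequence $(\delta_n)_n$ of positive reals with $\big|\,\|\sum_{i=1}^ka_iy_{n_i}\|-\|\sum_{i=1}^ka_ie_i\|\big|<\delta_{n_1}$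 for all $n_1<\dots<n_k$ with $k\le n_1$ and $a_1,\dots,a_k\in[-1,1]$. For Banach spaces $X,E$ write $X\to E$ if $E$ has a Schauder basis which is a spreading model of some seminormalized Schauder basic sequence in $X$, and $X\stackrel{l}{\to}E$ if $X\to E_1\to\dots\to E_{l-1}\to E$ for some Banach spaces $E_1,\dots,E_{l-1}$. A spreading Schauder basic sequence $(e_n)_n$ (spreading: $\|\sum_{j=1}^na_je_j\|=\|\sum_{j=1}^na_je_{k_j}\|$ for all $k_1<\dots<k_n$ and reals $a_j$) is an $l$-iterated spreading model of $X$ if $X\stackrel{l}{\to}E$, where $E$ is the closed linear span of $(e_n)_n$. *)

(* Defs.v *)
From HB Require Import structures.
From mathcomp Require Import all_boot all_order all_algebra finmap.
From mathcomp Require Import all_classical all_reals all_analysis.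

Set Implicit Arguments.
Unset Strict Implicit.
Unset Printing Implicit Defensive.

Import Order.TTheory GRing.Theory Num.Theory.
Import numFieldNormedType.Exports.

Local Open Scope classical_set_scope.
Local Open Scope ring_scope.

(* Indexing convention.  The set {1, 2, ...} is identified with [nat] through
   the order isomorphism n |-> n.-1, so that all sequences, tuples and
   enumerations of sets start at index 0.  Where an index is compared with a
   cardinality, the successor of the formal index is used: the condition
   k <= n_1 on the length k of a tuple reads (k <= n_0.+1)%N here. *)

(** Families of finite sets of natural numbers *)

Definition elts (s : {fset nat}) : seq nat := sort leq s.

(* the (i+1)-th element of s; meaningful for i < #|` s| only *)
Definition elt (s : {fset nat}) (i : nat) : nat := nth 0%N (elts s) i.

Definition init_seg (t s : {fset nat}) : bool := prefix (elts t) (elts s).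

Definition proper_init_seg (t s : {fset nat}) : bool :=
  (t != s) && init_seg t s.

Definition init_closure (F : set {fset nat}) : set {fset nat} :=
  [set t | exists2 s, F s & init_seg t s].

Definition restrict_family (F : set {fset nat}) (M : set nat) :
  set {fset nat} := [set s | F s /\ [set` s] `<=` M].

Definition thin (F : set {fset nat}) : Prop :=
  forall s t, F s -> F t -> ~~ proper_init_seg s t.

Definition hereditary (F : set {fset nat}) : Prop :=
  forall s t, F s -> (t `<=` s)%fset -> F t.

Definition spreading_family (F : set {fset nat}) : Prop :=
  forall s t, F s -> #|` t| = #|` s| ->
    (forall i, (i < #|` s|)%N -> (elt s i <= elt t i)%N) -> F t.

(* [cantor_space] is [nat -> bool] with the product topology *)
Definition compact_family (F : set {fset nat}) : Prop :=
  closed ([set (fun n => n \in s) | s in F] : set cantor_space).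

Definition regular_family (F : set {fset nat}) : Prop :=
  [/\ hereditary F, spreading_family F & compact_family F].

Definition regular_thin (F : set {fset nat}) : Prop :=
  thin F /\ regular_family (init_closure F).

(* [rk] is a rank function of the tree [T], with finite values.  The supremum
   of the empty set in [nat] is 0, which is the value at maximal elements. *)
Definition tree_rank (T : set {fset nat}) (rk : {fset nat} -> nat) : Prop :=
  forall s, T s ->
    isLub [set (rk t).+1 | t in [set t | T t /\ proper_init_seg s t]] (rk s).

(* o(F) = k for a finite ordinal k: since the rank of the root bounds all the
   other ranks, a [nat]-valued rank function suffices.  The root belongs to
   the tree exactly when F is nonempty; an empty F has no order. *)
Definition has_order (F : set {fset nat}) (k : nat) : Prop :=
  init_closure F fset0 /\
  exists2 rk : {fset nat} -> nat,
    tree_rank (init_closure F) rk & rk fset0 = k.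

Definition plegma (k : nat) (s : 'I_k -> {fset nat}) : Prop :=
  [/\ forall i, s i != fset0,
      forall (i j : 'I_k) m, (i < j)%N ->
        (m < minn #|` s i| #|` s j|)%N -> (elt (s i) m < elt (s j) m)%N
    & forall (i j : 'I_k) m,
        (m.+1 < minn #|` s i| #|` s j|)%N ->
        (elt (s i) m < elt (s j) m.+1)%N].

Definition increasing_tuple (k : nat) (n : 'I_k -> nat) : Prop :=
  forall i j : 'I_k, (i < j)%N -> (n i < n j)%N.

(** Sequences in (semi)normed spaces *)

Definition is_seminorm (R : realType) (V : lmodType R) (N : V -> R) : Prop :=
  (forall u v, N (u + v) <= N u + N v) /\
  (forall (a : R) u, N (a *: u) = `|a| * N u).

Definition lin_span (R : realType) (V : lmodType R) (e : nat -> V) : set V :=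
  [set v | exists n (a : nat -> R), v = \sum_(i < n) a i *: e i].

Definition hamel_basis (R : realType) (V : lmodType R) (e : nat -> V) : Prop :=
  (forall n (a : nat -> R), \sum_(i < n) a i *: e i = 0 ->
     forall i, (i < n)%N -> a i = 0) /\
  lin_span e = setT.

Definition equivalent_seq (R : realType) (V W : lmodType R)
    (N : V -> R) (e : nat -> V) (N' : W -> R) (e' : nat -> W) : Prop :=
  exists c C : R, [/\ 0 < c, 0 < C & forall n (a : nat -> R),
    c * N' (\sum_(i < n) a i *: e' i) <= N (\sum_(i < n) a i *: e i)
      <= C * N' (\sum_(i < n) a i *: e' i)].

(* The l^r norm of a finitely supported function, and the unit vectors. *)
Definition ell_norm (R : realType) (r : R) (f : nat -> R^o) : R :=
  fine ('N[@counting nat R]_(r%:E)[EFin \o f])%E.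

Definition ell_basis (R : realType) (i : nat) : nat -> R^o :=
  fun n => (n == i)%:R.

Definition equivalent_to_ell (R : realType) (V : lmodType R) (N : V -> R)
    (e : nat -> V) (r : R) : Prop :=
  equivalent_seq N e (@ell_norm R r) (@ell_basis R).

Definition null_pos_seq (R : realType) (d : nat -> R) : Prop :=
  (forall n, 0 < d n) /\ d n @[n --> \oo] --> (0 : R).

(** Bases *)

Definition converges_to (R : realType) (X : normedModType R)
    (e : nat -> X) (a : nat -> R) (v : X) : Prop :=
  (\sum_(i < n) a i *: e i) @[n --> \oo] --> v.

Definition schauder_basis (R : realType) (X : normedModType R)
    (e : nat -> X) : Prop :=
  forall v, exists! a : nat -> R, converges_to e a v.

(* a Schauder basis of its closed linear span *)
Definition schauder_basic (R : realType) (X : normedModType R)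
    (e : nat -> X) : Prop :=
  forall v, closure (lin_span e) v -> exists! a : nat -> R, converges_to e a v.

Definition unconditional_basis (R : realType) (X : normedModType R)
    (e : nat -> X) : Prop :=
  schauder_basis e /\
  forall (a : nat -> R) v, converges_to e a v ->
    forall f : nat -> nat, bijective f -> converges_to (e \o f) (a \o f) v.

Definition seminormalized (R : realType) (X : normedModType R)
    (x : nat -> X) : Prop :=
  exists c C : R, 0 < c /\ forall n, c <= `|x n| <= C.

Definition spreading_seq (R : realType) (X : normedModType R)
    (e : nat -> X) : Prop :=
  forall n (k : 'I_n -> nat) (a : 'I_n -> R), increasing_tuple k ->
    `|\sum_(j < n) a j *: e j| = `|\sum_(j < n) a j *: e (k j)|.

(** Reflexivity *)

Definition dual (R : realType) (X : normedModType R) : set (X -> R^o) :=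
  [set f | linear f /\ continuous f].

Definition dual_norm (R : realType) (X : normedModType R) (f : X -> R^o) : R :=
  sup [set `|f x| | x in [set x : X | `|x| <= 1]].

(* The values of [Phi] off the dual are irrelevant. *)
Definition bidual (R : realType) (X : normedModType R) :
    set ((X -> R^o) -> R) :=
  [set Phi |
     (forall (a : R) f g, dual f -> dual g ->
        Phi (fun x => a * f x + g x) = a * Phi f + Phi g) /\
     exists C : R, forall f, dual f -> `|Phi f| <= C * dual_norm f].

Definition reflexive_space (R : realType) (X : normedModType R) : Prop :=
  forall Phi, @bidual R X Phi -> exists x : X, forall f, dual f -> Phi f = f x.

(** Spreading models of order k *)

(* A map [x] on all of {fset nat} stands for the F-subsequence given by its
   values on F restricted to M.  The set M is given by its increasing
   enumeration.  The tuples have length k.+1 and l stands for l.+1. *)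
Definition generates_family_sm (R : realType) (X : normedModType R)
    (F : set {fset nat}) (M : nat -> nat) (x : {fset nat} -> X)
    (V : lmodType R) (N : V -> R) (e : nat -> V) : Prop :=
  exists2 d : nat -> R, null_pos_seq d &
    forall (k l : nat) (s : 'I_k.+1 -> {fset nat}) (a : 'I_k.+1 -> R),
      (k <= l)%N ->
      (forall j, restrict_family F (range M) (s j)) -> plegma s ->
      (M l <= elt (s ord0) 0)%N ->
      (forall j, -1 <= a j <= 1) ->
      `| `|\sum_(j < k.+1) a j *: x (s j)| - N (\sum_(j < k.+1) a j *: e j)|
        <= d l.

Definition admits_ell_sm_of_order (R : realType) (X : normedModType R)
    (q : R) (k : nat) : Prop :=
  exists (F : set {fset nat}) (M : nat -> nat) (x : {fset nat} -> X)
         (V : lmodType R) (N : V -> R) (e : nat -> V),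
    [/\ regular_thin F /\ has_order F k,
        increasing_seq M,
        is_seminorm N /\ hamel_basis e,
        generates_family_sm F M x N e
      & equivalent_to_ell N e q].

(** Iterated spreading models *)

Definition generates_sm (R : realType) (X E : normedModType R)
    (y : nat -> X) (e : nat -> E) : Prop :=
  exists2 d : nat -> R, null_pos_seq d &
    forall (k : nat) (n : 'I_k.+1 -> nat) (a : 'I_k.+1 -> R),
      increasing_tuple n -> (k.+1 <= (n ord0).+1)%N ->
      (forall i, -1 <= a i <= 1) ->
      `| `|\sum_(i < k.+1) a i *: y (n i)| - `|\sum_(i < k.+1) a i *: e i| |
        < d (n ord0).

Definition spreading_model (R : realType) (X E : normedModType R)
    (x : nat -> X) (e : nat -> E) : Prop :=
  exists2 m : nat -> nat, increasing_seq m & generates_sm (x \o m) e.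

Definition sm_step (R : realType) (X E : completeNormedModType R) : Prop :=
  exists (x : nat -> X) (e : nat -> E),
    [/\ schauder_basic x, seminormalized x, schauder_basis e
      & spreading_model x e].

Inductive iterated_sm_step (R : realType) :
    nat -> completeNormedModType R -> completeNormedModType R -> Prop :=
| iterated_sm_step1 X E : sm_step X E -> iterated_sm_step 1 X E
| iterated_sm_stepS l X E1 E :
    sm_step X E1 -> iterated_sm_step l E1 E -> iterated_sm_step l.+1 X E.

(* The ambient space E of the sequence e is its own closed linear span. *)
Definition iterated_spreading_model (R : realType) (l : nat)
    (X E : completeNormedModType R) (e : nat -> E) : Prop :=
  [/\ schauder_basic e, spreading_seq e, closure (lin_span e) = setT
    & iterated_sm_step l X E].

(* Main.v *)
Require Import Defs.
From HB Require Import structures.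
From mathcomp Require Import all_boot all_order all_algebra finmap.
From mathcomp Require Import all_classical all_reals all_analysis.
From mathcomp Require Import zify ring lra.
Import Order.TTheory GRing.Theory Num.Theory.
Import numFieldNormedType.Exports.

Set Implicit Arguments.
Unset Strict Implicit.
Unset Printing Implicit Defensive.

Local Open Scope classical_set_scope.
Local Open Scope ring_scope.

(* The space X consists of sequences x, the index s being thought of as a pair
   (row of s, s) with row s <= s.  A set A of indices is admissible if
   row s <= s' for all s, s' in A; on such a set x is measured by the l^q sum
   over the rows of the l^p norms in the rows, and the norm of x is the
   supremum of the l^p sums of these quantities over families of disjoint
   admissible sets.

   The vectors e_s, s = (row m, index >= n), for a plegma family of pairs
   (m, n) have distinct rows and form an admissible set, since every m lies
   below every n; so they span l^q isometrically, and l^q is a spreading model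
   of order 2, hence of every order k > 1.

   Conversely, let (x_n) be bounded in X, converging coordinatewise to z.
   After passing to a subsequence, x_n - z is close to a block sequence v_j
   supported in [L_j, L_{j+1}).  In the part of v_j in the rows >= L_j no
   admissible set meets two blocks, so these parts span l^p exactly.  The part
   in the rows < L_j lies on an admissible set, so its l^p norms in the rows are
   bounded in l^q, and for a subsequence they are dominated by one sequence in
   l^q; by Minkowski's inequality these parts have an upper l^p estimate as
   well.  Disjoint vectors have a lower l^p estimate.  Hence a spreading model
   which is a Schauder basis is equivalent to the basis of l^p (z = 0, because
   otherwise the averages of the spreading model converge to a nonzero vector
   without coordinates).  As l^p embeds in X (as row 0), the same applies to
   iterated spreading models. *)

(** * Finite l^p norms *)

(** Only the first [n] coordinates count. The definition is locked, so that it unfolds through [pnE]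
    alone and never by computation. *)
HB.lock Definition pn (R : realType) (p : R) (n : nat) (f : nat -> R) : R :=
  (\sum_(i < n) `|f i| `^ p) `^ p^-1.

Section FiniteLpNorm.
Variable R : realType.
Implicit Types (p q a : R) (n : nat) (f g h : nat -> R).

Lemma pnE p n f : pn p n f = (\sum_(i < n) `|f i| `^ p) `^ p^-1.
Proof. by rewrite pn.unlock. Qed.

Lemma pn_ge0 p n f : 0 <= pn p n f.
Proof. by rewrite pnE; exact: powR_ge0. Qed.
#[local] Hint Extern 0 (is_true (0 <= pn _ _ _)) => exact: pn_ge0 : core.

Lemma powRK p a : p != 0 -> 0 <= a -> (a `^ p) `^ p^-1 = a.
Proof. by move=> p0 a0; rewrite -powRrM divff// powRr1. Qed.

Lemma powRVK p a : p != 0 -> 0 <= a -> (a `^ p^-1) `^ p = a.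
Proof. by move=> p0 a0; rewrite -powRrM mulVf// powRr1. Qed.

Lemma ler_powRl p a b : 0 <= p -> 0 <= a -> a <= b -> a `^ p <= b `^ p.
Proof.
by move=> p0 a0 ab; apply: (ge0_ler_powR p0); rewrite ?nnegrE ?(le_trans a0).
Qed.

Lemma ler_powR_iff p a b : 0 < p -> 0 <= a -> 0 <= b ->
  (a `^ p <= b `^ p) = (a <= b).
Proof.
move=> p0 a0 b0; apply/idP/idP; last by apply: ler_powRl => //; exact: ltW.
rewrite leNgt => ab; rewrite leNgt; apply: contra ab => ba.
by apply: (gt0_ltr_powR p0); rewrite ?nnegrE.
Qed.

Lemma powR_div p a b : 0 <= a -> 0 <= b -> (a / b) `^ p = a `^ p / b `^ p.
Proof.
move=> a0 b0; rewrite powRM ?invr_ge0//; congr (_ * _).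
by rewrite -(powR_inv1 b0) -(powR_inv1 (powR_ge0 b p)) powRAC.
Qed.

Lemma sum_powR_ge0 p n f : 0 <= \sum_(i < n) `|f i| `^ p.
Proof. by apply: sumr_ge0 => i _; exact: powR_ge0. Qed.
#[local] Hint Extern 0 (is_true (0 <= \sum_(i < _) `|_| `^ _)) => exact: sum_powR_ge0 : core.

Lemma pn_pow p n f : 0 < p -> pn p n f `^ p = \sum_(i < n) `|f i| `^ p.
Proof. by move=> p0; rewrite pnE powRVK// gt_eqF. Qed.

Lemma pn_le_pow p n f b : 0 < p -> 0 <= b ->
  (pn p n f <= b) = (\sum_(i < n) `|f i| `^ p <= b `^ p).
Proof. by move=> p0 b0; rewrite -(@ler_powR_iff p)// pn_pow. Qed.

Lemma pn_ge_pow p n f b : 0 < p -> 0 <= b ->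
  (b <= pn p n f) = (b `^ p <= \sum_(i < n) `|f i| `^ p).
Proof. by move=> p0 b0; rewrite -(@ler_powR_iff p)// pn_pow. Qed.

Lemma ler_pn_widen p n m f g : 0 < p -> (n <= m)%N ->
  (forall i, (i < n)%N -> `|f i| <= `|g i|) -> pn p n f <= pn p m g.
Proof.
move=> p0 nm fg; rewrite pn_le_pow// pn_pow// (big_ord_widen _ (fun i => `|f i| `^ p) nm).
rewrite big_mkcond; apply: ler_sum => i _; case: ifP => [ni|_]; last exact: powR_ge0.
by apply: ler_powRl (fg _ ni) => //; exact: ltW.
Qed.

Lemma ler_pn p n f g : 0 < p ->
  (forall i, (i < n)%N -> `|f i| <= `|g i|) -> pn p n f <= pn p n g.
Proof. by move=> p0; exact: ler_pn_widen. Qed.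

Lemma eq_pn p n f g :
  (forall i, (i < n)%N -> `|f i| = `|g i|) -> pn p n f = pn p n g.
Proof. by move=> fg; rewrite !pnE; congr (_ `^ _); apply: eq_bigr => i _; rewrite fg. Qed.

Lemma pnZ p n a f : 0 < p -> pn p n (fun i => a * f i) = `|a| * pn p n f.
Proof.
move=> p0; rewrite !pnE -[in RHS](@powRK p `|a|) ?gt_eqF//.
rewrite -powRM ?powR_ge0// mulr_sumr.
by congr (_ `^ _); apply: eq_bigr => i _; rewrite normrM powRM.
Qed.

Lemma pn0 p n : 0 < p -> pn p n (fun=> 0) = 0.
Proof.
by move=> p0; have := @pnZ p n 0 (fun=> 0) p0; rewrite normr0 !mul0r.
Qed.

Lemma ler_pn_coord p n f i : 0 < p -> (i < n)%N -> `|f i| <= pn p n f.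
Proof.
move=> p0 ni; rewrite pn_ge_pow// (bigD1 (Ordinal ni))//= lerDl.
by apply: sumr_ge0 => j _; exact: powR_ge0.
Qed.

Lemma pn_eq0P p n f : 0 < p -> pn p n f = 0 -> forall i, (i < n)%N -> f i = 0.
Proof.
by move=> p0 f0 i ni; apply/eqP; rewrite -normr_le0 -f0 ler_pn_coord.
Qed.

(** Young's inequality for the conjugate exponents p/(p-1) and p, written with the factor
    [u ^ (p - 1)] in which the norming functional comes. The dual norm therefore never has to be
    introduced. *)
Lemma young p (u v : R) : 1 < p -> 0 <= u -> 0 <= v ->
  u `^ (p - 1) * v <= (1 - p^-1) * u `^ p + p^-1 * v `^ p.
Proof.
move=> p1 u0 v0; have p0 : 0 < p by lra.
have P0 : 0 < p - 1 by lra.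
have q0 : 0 < p / (p - 1) by rewrite divr_gt0.
have pq : (p / (p - 1))^-1 + p^-1 = 1.
  by rewrite invf_div -[X in _ + X]mul1r -mulrDl subrK divff// gt_eqF.
have := conjugate_powR (powR_ge0 u (p - 1)) v0 q0 p0 pq.
rewrite -powRrM mulrCA divff ?mulr1 ?gt_eqF// => /le_trans; apply.
by rewrite mulrC -[X in X * u `^ p](addrK p^-1) pq [p^-1 * _]mulrC.
Qed.

Lemma sum_young p n (u v : nat -> R) : 1 < p ->
  (forall i, 0 <= u i) -> (forall i, 0 <= v i) ->
  \sum_(i < n) u i `^ p = 1 -> \sum_(i < n) v i `^ p = 1 ->
  \sum_(i < n) u i `^ (p - 1) * v i <= 1.
Proof.
move=> p1 u0 v0 su sv.
apply: le_trans (_ : \sum_(i < n) ((1 - p^-1) * u i `^ p + p^-1 * v i `^ p) <= _).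
  by apply: ler_sum => i _; exact: young.
by rewrite big_split/= -mulr_sumr -mulr_sumr su sv !mulr1 subrK.
Qed.

(** A functional of norm at most 1 that attains the norm of [f]. Evaluated at a sum it yields the
    triangle inequality; as a finite combination of coordinates it also serves the proof of
    reflexivity. *)
Lemma pn_norming p n f : 1 < p -> exists g : nat -> R,
  (forall h, `|\sum_(i < n) g i * h i| <= pn p n h) /\
  \sum_(i < n) g i * f i = pn p n f.
Proof.
move=> p1; have p0 : 0 < p by lra.
have [f0|fn0] := eqVneq (pn p n f) 0.
  exists (fun=> 0); split=> [h|]; first by rewrite big1 ?normr0// => i; rewrite mul0r.
  by rewrite f0 big1// => i; rewrite mul0r.
have fp : 0 < pn p n f by rewrite lt_def fn0 pn_ge0.
(* The derivative of the norm at [f]; by [sum_young] it is bounded by 1 on the unit ball. *)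
exists (fun i => Num.sg (f i) * (`|f i| / pn p n f) `^ (p - 1)); split=> [h|].
  have [h0|hn0] := eqVneq (pn p n h) 0.
    rewrite h0 big1 ?normr0// => i _.
    by rewrite (pn_eq0P p0 h0)// mulr0.
  have hp : 0 < pn p n h by rewrite lt_def hn0 pn_ge0.
  have norm1 k : pn p n k != 0 -> \sum_(i < n) (`|k i| / pn p n k) `^ p = 1.
    move=> kn0; under eq_bigr do rewrite (powR_div _ (normr_ge0 _) (pn_ge0 _ _ _)).
    by rewrite -mulr_suml -pn_pow// divff// powR_eq0 negb_and kn0.
  apply: le_trans (ler_norm_sum _ _ _) _.
  rewrite -[leRHS]mul1r -ler_pdivrMr// mulr_suml.
  apply: le_trans (@sum_young p n (fun i => `|f i| / pn p n f) (fun i => `|h i| / pn p n h) _ _ _ _ _) => //.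
  - apply: ler_sum => i _.
    rewrite !normrM normr_sg (ger0_norm (powR_ge0 _ _)) -!mulrA.
    apply: ler_piMl; last by case: eqP.
    by apply: mulr_ge0 (powR_ge0 _ _) (divr_ge0 (normr_ge0 _) (pn_ge0 _ _ _)).
  - by move=> i; exact: divr_ge0 (normr_ge0 _) (pn_ge0 _ _ _).
  - by move=> i; exact: divr_ge0 (normr_ge0 _) (pn_ge0 _ _ _).
  - exact: norm1.
  - exact: norm1.
rewrite (eq_bigr (fun i : 'I_n => (`|f i| / pn p n f) `^ p * pn p n f)); last first.
  move=> i _; rewrite mulrAC -normrEsg.
  rewrite -[X in X * _ = _](divfK fn0) mulrAC.
  by rewrite mulr_powRB1 ?divr_ge0.
rewrite -mulr_suml; under eq_bigr do rewrite (powR_div _ (normr_ge0 _) (pn_ge0 _ _ _)).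
by rewrite -mulr_suml -pn_pow// divff ?mul1r// powR_eq0 negb_and fn0.
Qed.

Lemma ler_pnD p n f g : 1 < p ->
  pn p n (fun i => f i + g i) <= pn p n f + pn p n g.
Proof.
move=> p1; have [u [uh <-]] := pn_norming n (fun i => f i + g i) p1.
under eq_bigr do rewrite mulrDr.
by rewrite big_split/= lerD// (le_trans (ler_norm _)).
Qed.

Lemma ler_pn_sum p n m (f : nat -> nat -> R) : 1 < p ->
  pn p n (fun i => \sum_(j < m) f j i) <= \sum_(j < m) pn p n (f j).
Proof.
move=> p1; have p0 : 0 < p by lra.
elim: m => [|m IH].
  rewrite big_ord0 le_eqVlt -[X in _ == X](@pn0 p n)//; apply/orP; left.
  by apply/eqP/eq_pn => i _; rewrite big_ord0.
rewrite big_ord_recr/=; apply: le_trans (lerD IH (lexx _)).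
apply: le_trans (ler_pnD _ _ _ p1).
by apply: ler_pn => // i _; rewrite big_ord_recr.
Qed.

Lemma pn_powR p q n f : 0 < p -> 0 < q ->
  pn p n f `^ q = pn (p / q) n (fun i => `|f i| `^ q).
Proof.
move=> p0 q0; rewrite !pnE -powRrM invf_div mulrC; congr (_ `^ _).
apply: eq_bigr => i _; rewrite [in RHS]ger0_norm ?powR_ge0// -powRrM.
by rewrite mulrCA divff ?mulr1// gt_eqF.
Qed.

(** Minkowski's inequality for mixed norms: after raising to the power [q] it is the triangle
    inequality in l^(p/q), where p/q > 1. *)
Lemma pn_swap p q K n (a : nat -> nat -> R) : 0 < q -> q < p ->
  pn p K (fun t => pn q n (a t)) <= pn q n (fun i => pn p K (a ^~ i)).
Proof.
move=> q0 qp; have p0 : 0 < p by lra.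
have pq : 1 < p / q by rewrite ltr_pdivlMr// mul1r.
rewrite pn_ge_pow// pn_powR//.
apply: le_trans (_ : pn (p / q) K
    (fun t => \sum_(i < n) `|a t i| `^ q) <= _).
  apply: ler_pn => [|t _]; first by lra.
  by rewrite ger0_norm ?powR_ge0// ger0_norm// pn_pow// ger0_norm.
apply: le_trans (@ler_pn_sum _ K n (fun i t => `|a t i| `^ q) pq) _.
apply: ler_sum => i _; rewrite ger0_norm// pn_powR//.
Qed.

(** Each term factors as |f i|^(p-q) |f i|^q, and the first factor is at most the (p-q)-th power of
    the l^q norm. *)
Lemma pn_mono p q n f : 0 < q -> q <= p -> pn p n f <= pn q n f.
Proof.
move=> q0 qp; have p0 : 0 < p by lra.
rewrite pn_le_pow//.
have [f0|fn0] := eqVneq (pn q n f) 0.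
  rewrite big1 ?powR_ge0// => i _; rewrite (pn_eq0P q0 f0)// normr0 powR0//.
  by rewrite gt_eqF.
rewrite -[p](subrK q) powRD; last by rewrite fn0 implybT.
rewrite pn_pow// mulr_sumr; apply: ler_sum => i _.
have [->|fi] := eqVneq (f i) 0.
  by rewrite normr0 powR0 ?mulr_ge0 ?powR_ge0// subrK gt_eqF.
rewrite powRD; last by rewrite normr_eq0 fi implybT.
rewrite ler_wpM2r ?powR_ge0// ler_powRl ?subr_ge0//.
exact: ler_pn_coord.
Qed.

Lemma pn1 n f : pn 1 n f = \sum_(i < n) `|f i|.
Proof.
rewrite !pnE invr1 powRr1 => //; apply: eq_bigr => i _; exact: powRr1.
Qed.

Lemma ler_pn_l1 p n f : 1 <= p -> pn p n f <= \sum_(i < n) `|f i|.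
Proof. by move=> p1; rewrite -pn1; exact: pn_mono. Qed.

End FiniteLpNorm.
#[global] Hint Extern 0 (is_true (0 <= pn _ _ _)) => exact: pn_ge0 : core.

(** * The norm *)

Section PlegmaNorm.
Variables (R : realType) (p q : R) (r : nat -> nat).
Hypothesis (q1 : 1 < q) (qp : q < p) (r_le : forall s, (r s <= s)%N).
Implicit Types (x y : nat -> R) (n K : nat) (c : nat -> nat) (B : pred nat).

Let p1 : 1 < p. Proof. exact: lt_trans qp. Qed.
Let p0 : 0 < p. Proof. exact: lt_trans p1. Qed.
Let q0 : 0 < q. Proof. exact: lt_trans q1. Qed.

(* A colouring c encodes the disjoint sets of the s < n of a given colour t < K;
   the indices of colour >= K belong to none of them. *)
Definition cell n c (t : nat) x (i : nat) : R := pn p n (fun s => x s *+ ((c s == t) && (r s == i))).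
(** The rows [i < n] suffice: by [r s <= s] every index [s < n] lies in one of them. *)
Definition nu n c t x : R := pn q n (cell n c t x).
Definition colnorm n K c x : R := pn p K (fun t => nu n c t x).

Definition admissible n K c : Prop := forall s s',
  (s < n)%N -> (s' < n)%N -> c s = c s' -> (c s < K)%N -> (r s <= s')%N.

(** Upper estimates are stated in this form because it includes the finiteness of the supremum,
    about which the real-valued [sup] says nothing. *)
Definition bounded_by x (b : R) : Prop :=
  forall n K c, admissible n K c -> colnorm n K c x <= b.
Definition inX x : Prop := exists b, bounded_by x b.
Definition colset x : set R :=
  [set v | exists n K c, admissible n K c /\ v = colnorm n K c x].
Definition xnorm x : R := sup (colset x).

Definition restr B x : nat -> R := fun s => x s *+ B s.
Definition comb n (a : nat -> R) (v : nat -> nat -> R) : nat -> R :=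
  fun s => \sum_(j < n) a j * v j s.

Lemma restr_le B x s : `|restr B x s| <= `|x s|.
Proof. by rewrite /restr; case: (B s); rewrite ?mulr1n// mulr0n normr0. Qed.

(** Lengths, colourings and colours may all differ between the two sides, so that the lemma covers
    monotonicity in [x] as well as the regluing of colourings. Only the nonzero entries of [x] are
    constrained. *)
Lemma cell_le n m c c' t t' x y i : (n <= m)%N ->
  (forall s, (s < n)%N -> x s != 0 -> c s = t -> c' s = t' /\ `|x s| <= `|y s|) ->
  cell n c t x i <= cell m c' t' y i.
Proof.
move=> nm xy; apply: ler_pn_widen => // s sn.
have [->|xs] := eqVneq (x s) 0; first by rewrite mul0rn normr0.
case: eqP => [cs|_]; last by rewrite mulr0n normr0.
have [-> ?] := xy _ sn xs cs; rewrite eqxx/=.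
by case: eqP => _; rewrite ?mulr1n// mulr0n normr0.
Qed.

Lemma cell_ge0 n c t x i : 0 <= cell n c t x i. Proof. exact: pn_ge0. Qed.
Lemma nu_ge0 n c t x : 0 <= nu n c t x. Proof. exact: pn_ge0. Qed.
Lemma colnorm_ge0 n K c x : 0 <= colnorm n K c x. Proof. exact: pn_ge0. Qed.

Lemma nu_le n m c c' t t' x y : (n <= m)%N ->
  (forall s, (s < n)%N -> x s != 0 -> c s = t -> c' s = t' /\ `|x s| <= `|y s|) ->
  nu n c t x <= nu m c' t' y.
Proof.
move=> nm xy; apply: ler_pn_widen => // i _.
by rewrite !ger0_norm ?cell_ge0//; exact: cell_le.
Qed.

Lemma colnorm_le n K c x y : (forall s, (s < n)%N -> `|x s| <= `|y s|) ->
  colnorm n K c x <= colnorm n K c y.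
Proof.
move=> xy; apply: ler_pn => // t _; rewrite !ger0_norm ?nu_ge0//.
by apply: nu_le => // s sn _ ->; split=> //; exact: xy.
Qed.

Lemma nuZ n c t a x : nu n c t (fun s => a * x s) = `|a| * nu n c t x.
Proof.
rewrite /nu -(@normr_id _ _ a) -pnZ//; apply: eq_pn => i _; congr `|_|.
by rewrite /cell -pnZ//; apply: eq_pn => s _; rewrite mulrnAr.
Qed.

Lemma colnormZ n K c a x :
  colnorm n K c (fun s => a * x s) = `|a| * colnorm n K c x.
Proof.
rewrite /colnorm -(@normr_id _ _ a) -pnZ//; apply: eq_pn => t _; congr `|_|.
exact: nuZ.
Qed.

(** Norming functionals of an iterated norm are composed from those of its three layers: colours,
    rows and cells. *)
Lemma colnorm_norming n K c y : exists g : nat -> R,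
  (forall h : nat -> R, `|\sum_(s < n) g s * h s| <= colnorm n K c h) /\
  \sum_(s < n) g s * y s = colnorm n K c y.
Proof.
have /choice[d dP] : forall ti : nat * nat, exists g : nat -> R,
    (forall h : nat -> R, `|\sum_(s < n) g s * h s| <= pn p n h) /\
    \sum_(s < n) g s * (y s *+ ((c s == ti.1) && (r s == ti.2))) =
      cell n c ti.1 y ti.2.
  by move=> ti; exact: pn_norming.
have /choice[e eP] : forall t : nat, exists g : nat -> R,
    (forall h : nat -> R, `|\sum_(s < n) g s * h s| <= pn q n h) /\
    \sum_(s < n) g s * cell n c t y s = nu n c t y.
  by move=> t; exact: pn_norming.
have [f [fP fy]] := pn_norming K (fun t => nu n c t y) p1.
(* [f] acts over the colours, [e t] over the rows and [d (t, i)] inside a cell; the indicator keeps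
   each index in its own cell. *)
pose g s := \sum_(t < K) f t * \sum_(i < n) e t i *
  (d ((t : nat), (i : nat)) s *+ ((c s == t) && (r s == i))).
pose u (h : nat -> R) t i := \sum_(s < n) d (t, i) s * (h s *+ ((c s == t) && (r s == i))).
have gE (h : nat -> R) : \sum_(s < n) g s * h s =
    \sum_(t < K) f t * \sum_(i < n) e t i * u h t i.
  transitivity (\sum_(s < n) \sum_(t < K) \sum_(i < n) f t * (e t i *
      (d ((t : nat), (i : nat)) s * (h s *+ ((c s == t) && (r s == i)))))).
    apply: eq_bigr => s _; rewrite mulr_suml; apply: eq_bigr => t _.
    rewrite -mulrA mulr_suml mulr_sumr; apply: eq_bigr => i _.
    by congr (_ * _); rewrite -mulrA; congr (_ * _); rewrite mulrnAl mulrnAr.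
  rewrite exchange_big; apply: eq_bigr => t _.
  rewrite mulr_sumr exchange_big; apply: eq_bigr => i _.
  by rewrite !mulr_sumr.
exists g; split=> [h|]; rewrite gE.
  apply: le_trans (fP (fun t => \sum_(i < n) e t i * u h t i)) _; apply: ler_pn => // t _.
  rewrite [leRHS]ger0_norm ?nu_ge0//.
  apply: le_trans ((eP t).1 (u h t)) _; apply: ler_pn => // i _.
  by rewrite [leRHS]ger0_norm ?cell_ge0//; exact: (dP (t, i)).1.
rewrite -[RHS]fy; apply: eq_bigr => t _; congr (_ * _).
rewrite -[RHS](eP t).2; apply: eq_bigr => i _; congr (_ * _).
exact: (dP ((t : nat), (i : nat))).2.
Qed.

Lemma colnormD n K c x y :
  colnorm n K c (fun s => x s + y s) <= colnorm n K c x + colnorm n K c y.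
Proof.
have [g [gP <-]] := colnorm_norming n K c (fun s => x s + y s).
under eq_bigr do rewrite mulrDr.
by rewrite big_split/= lerD// (le_trans (ler_norm _)).
Qed.

Lemma sum_colour_le (z : R) K (k : nat) (b : bool) :
  \sum_(t < K) `|z *+ ((k == t) && b)| `^ p <= `|z *+ b| `^ p.
Proof.
have [kK|kK] := ltnP k K; last first.
  rewrite big1 ?powR_ge0// => t _.
  by rewrite gtn_eqF ?(leq_trans _ kK)// mulr0n normr0 powR0// gt_eqF.
rewrite (bigD1 (Ordinal kK))//= eqxx/= big1 ?addr0// => t /negPf tk.
have -> : (k == t) = false by apply: contraFF tk => /eqP kt; apply/eqP/val_inj.
by rewrite mulr0n normr0 powR0// gt_eqF.
Qed.

(** * Upper estimates by row norms and by the l^q norm *)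

Definition rownorm n x (i : nat) : R := pn p n (fun s => x s *+ (r s == i)).

(** As q < p, [pn_swap] moves the l^p sum over the colours inside the l^q sum over the rows; there
    the colours split each row into disjoint pieces. *)
Lemma colnorm_rows n K c x : colnorm n K c x <= pn q n (rownorm n x).
Proof.
apply: le_trans (pn_swap _ _ _ q0 qp) _; apply: ler_pn => // i _.
rewrite !ger0_norm ?pn_ge0// pn_le_pow ?pn_ge0// pn_pow//.
rewrite (eq_bigr (fun t : 'I_K => \sum_(s < n) `|x s *+ ((c s == t) && (r s == i))| `^ p)).
  by rewrite exchange_big; apply: ler_sum => s _; exact: sum_colour_le.
by move=> t _; rewrite ger0_norm ?cell_ge0// pn_pow.
Qed.

(** Within a row the l^p norm is at most the l^q norm, and the rows partition the indices. *)
Lemma colnorm_pn n K c x : colnorm n K c x <= pn q n x.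
Proof.
apply: le_trans (colnorm_rows n K c x) _; rewrite pn_le_pow ?pn_ge0//.
apply: le_trans (_ : \sum_(i < n) \sum_(s < n) `|x s *+ (r s == i)| `^ q <= _).
  apply: ler_sum => i _; rewrite ger0_norm ?pn_ge0// -(pn_pow n (fun s => x s *+ (r s == i)) q0).
  by apply: ler_powRl; rewrite ?pn_ge0 ?(ltW q0)// pn_mono// ltW.
rewrite exchange_big pn_pow//; apply: ler_sum => s _.
rewrite (bigD1 (Ordinal (leq_ltn_trans (r_le s) (ltn_ord s))))//= eqxx big1 ?addr0//.
move=> i /negPf si; have -> : (r s == i) = false.
  by apply: contraFF si => /eqP kt; apply/eqP/val_inj.
by rewrite mulr0n normr0 powR0// gt_eqF.
Qed.

Lemma colnorm_l1 n K c x : colnorm n K c x <= \sum_(s < n) `|x s|.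
Proof. exact: le_trans (colnorm_pn _ _ _ _) (ler_pn_l1 _ _ (ltW q1)). Qed.

(** * The supremum over all admissible colourings *)

Lemma admissible0 : admissible 0 0 (fun=> 0%N). Proof. by []. Qed.

Lemma colset_nonempty x : (colset x !=set0)%classic.
Proof.
by exists (colnorm 0 0 (fun=> 0%N) x), 0%N, 0%N, (fun=> 0%N).
Qed.

Lemma bounded_xnorm x b : bounded_by x b -> xnorm x <= b.
Proof.
move=> xb; apply: ge_sup; first exact: colset_nonempty.
by move=> _ [n [K [c [nKc ->]]]]; exact: xb.
Qed.

Lemma colnorm_xnorm n K c x : inX x -> admissible n K c ->
  colnorm n K c x <= xnorm x.
Proof.
move=> [b xb] nKc; apply: sup_upper_bound; last by exists n, K, c.
split; first exact: colset_nonempty.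
by exists b => _ [m [K' [c' [adm ->]]]]; exact: xb.
Qed.

Lemma xnorm_bounded x : inX x -> bounded_by x (xnorm x).
Proof. by move=> xX n K c; exact: colnorm_xnorm. Qed.

Lemma bounded_inX x b : bounded_by x b -> inX x. Proof. by exists b. Qed.

Lemma xnorm_ge0 x : inX x -> 0 <= xnorm x.
Proof.
by move=> xX; apply: le_trans (colnorm_xnorm xX admissible0); exact: colnorm_ge0.
Qed.

Lemma xnorm_approx x e : inX x -> 0 < e ->
  exists n K c, admissible n K c /\ xnorm x - e < colnorm n K c x.
Proof.
move=> [b xb] e0; have hs : has_sup (colset x).
  split; first exact: colset_nonempty.
  by exists b => _ [m [K' [c' [adm ->]]]]; exact: xb.
by have [_ [n [K [c [nKc ->]]]] ?] := sup_adherent e0 hs; exists n, K, c.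
Qed.

Lemma bounded_mono x y b : (forall s, `|x s| <= `|y s|) ->
  bounded_by y b -> bounded_by x b.
Proof.
by move=> xy yb n K c nKc; apply: le_trans (yb _ _ _ nKc); exact: colnorm_le.
Qed.

Lemma inX_mono x y : (forall s, `|x s| <= `|y s|) -> inX y -> inX x.
Proof. by move=> xy [b yb]; exists b; exact: bounded_mono yb. Qed.

Lemma xnorm_mono x y : (forall s, `|x s| <= `|y s|) -> inX y ->
  xnorm x <= xnorm y.
Proof.
by move=> xy yX; apply: bounded_xnorm; apply: bounded_mono xy _; exact: xnorm_bounded.
Qed.

Lemma eq_xnorm x y : x =1 y -> xnorm x = xnorm y.
Proof. by move=> /funext ->. Qed.

Lemma inX_restr B x : inX x -> inX (restr B x).
Proof. by apply: inX_mono => s; exact: restr_le. Qed.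

Lemma xnorm_restr B x : inX x -> xnorm (restr B x) <= xnorm x.
Proof. by apply: xnorm_mono => s; exact: restr_le. Qed.

Lemma boundedD x y b b' : bounded_by x b -> bounded_by y b' ->
  bounded_by (fun s => x s + y s) (b + b').
Proof.
move=> xb yb n K c nKc; apply: le_trans (colnormD _ _ _ _ _) _.
by rewrite lerD ?xb ?yb.
Qed.

Lemma inXD x y : inX x -> inX y -> inX (fun s => x s + y s).
Proof. by move=> [b xb] [b' yb]; exists (b + b'); exact: boundedD. Qed.

Lemma xnormD x y : inX x -> inX y ->
  xnorm (fun s => x s + y s) <= xnorm x + xnorm y.
Proof.
by move=> xX yX; apply: bounded_xnorm; apply: boundedD; exact: xnorm_bounded.
Qed.

Lemma inXZ a x : inX x -> inX (fun s => a * x s).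
Proof.
move=> [b xb]; exists (`|a| * b) => n K c nKc.
by rewrite colnormZ ler_wpM2l ?xb.
Qed.

Lemma xnormZ_le a x : inX x -> xnorm (fun s => a * x s) <= `|a| * xnorm x.
Proof.
move=> xX; apply: bounded_xnorm => n K c nKc.
by rewrite colnormZ ler_wpM2l ?colnorm_xnorm.
Qed.

Lemma inX0 : inX (fun=> 0).
Proof.
exists 0 => n K c _; apply: le_trans (colnorm_l1 _ _ _ _) _.
by rewrite big1// => i _; rewrite normr0.
Qed.

Lemma xnorm0 : xnorm (fun=> 0) = 0.
Proof.
apply/eqP; rewrite eq_le xnorm_ge0 ?andbT; last exact: inX0.
apply: bounded_xnorm => n K c _; apply: le_trans (colnorm_l1 _ _ _ _) _.
by rewrite big1// => i _; rewrite normr0.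
Qed.

Lemma xnormZ a x : inX x -> xnorm (fun s => a * x s) = `|a| * xnorm x.
Proof.
move=> xX; apply/eqP; rewrite eq_le xnormZ_le//=.
have [->|a0] := eqVneq a 0; first by rewrite normr0 mul0r xnorm_ge0//; exact: inXZ.
rewrite -ler_pdivlMl ?normr_gt0// -normfV.
rewrite -{1}(_ : (fun s => a^-1 * (a * x s)) = x); last first.
  by apply/funext => s; rewrite mulKf.
by apply: xnormZ_le; exact: inXZ.
Qed.

(** * Lower estimates *)

Lemma class_le_xnorm n (A : pred nat) x : inX x ->
  (forall s s', (s < n)%N -> (s' < n)%N -> A s -> A s' -> (r s <= s')%N) ->
  pn q n (rownorm n (restr A x)) <= xnorm x.
Proof.
(* Only colour 0 counts when [K = 1]; colour 1 discards the indices outside [A]. *)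
move=> xX hA; pose c s := if A s then 0%N else 1%N.
have nKc : admissible n 1 c.
  move=> s s' sn s'n; rewrite /c; case: ifP => // As; case: ifP => // As' _ _.
  exact: hA.
apply: le_trans (colnorm_xnorm xX nKc).
apply: le_trans (_ : `|nu n c 0 x| <= _); last exact: ler_pn_coord.
rewrite ger0_norm ?nu_ge0//; apply: ler_pn => // i _.
rewrite !ger0_norm ?pn_ge0//; apply: ler_pn => // s _.
rewrite /restr /c; case: (A s); rewrite ?mulr1n//=.
by rewrite mulr0n mul0rn normr0.
Qed.

Lemma rownorm_coord n x s : (s < n)%N -> `|x s| <= rownorm n x (r s).
Proof.
move=> sn; have := @ler_pn_coord _ p n (fun s' => x s' *+ (r s' == r s)) s p0 sn.
by rewrite eqxx.
Qed.

(** The singleton of [s] is admissible because [r s <= s]. *)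
Lemma xnorm_coord x s : inX x -> `|x s| <= xnorm x.
Proof.
move=> xX; apply: le_trans (@class_le_xnorm s.+1 (pred1 s) x xX _); last first.
  by move=> s1 s2 _ _ /eqP-> /eqP->.
apply: le_trans (_ : `|rownorm s.+1 (restr (pred1 s) x) (r s)| <= _).
  have := rownorm_coord (restr (pred1 s) x) (ltnSn s).
  by rewrite {1}/restr /= eqxx mulr1n => /le_trans; apply; exact: ler_norm.
by apply: ler_pn_coord => //; rewrite ltnS.
Qed.

Lemma xnorm_eq0 x : inX x -> xnorm x = 0 -> x =1 (fun=> 0).
Proof.
by move=> xX x0 s; apply/eqP; rewrite -normr_le0 -x0; exact: xnorm_coord.
Qed.

Lemma xnorm_powR_le x b : inX x -> 0 <= b ->
  (forall n K c, admissible n K c -> colnorm n K c x `^ p <= b) ->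
  xnorm x `^ p <= b.
Proof.
move=> xX b0 xb; rewrite -[b](@powRVK _ p) ?gt_eqF//.
apply: ler_powRl; rewrite ?(ltW p0) ?xnorm_ge0//.
apply: bounded_xnorm => n K c nKc.
by rewrite -(@ler_powR_iff _ p) ?colnorm_ge0 ?powR_ge0// powRVK ?gt_eqF// xb.
Qed.

(** The lower l^p estimate for disjoint vectors: one admissible colouring used on [B] and another
    used off [B] combine into one, as no condition relates different colours. *)
Lemma colnorm_split n1 K1 c1 n2 K2 c2 B x : inX x ->
  admissible n1 K1 c1 -> admissible n2 K2 c2 ->
  colnorm n1 K1 c1 (restr B x) `^ p + colnorm n2 K2 c2 (restr (predC B) x) `^ p
    <= xnorm x `^ p.
Proof.
move=> xX a1 a2; pose n := maxn n1 n2.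
(* The colours of the second colouring are shifted by [K1], and [K1 + K2] marks the discarded
   indices. *)
pose c s := if B s then if (s < n1)%N && (c1 s < K1)%N then c1 s else (K1 + K2)%N
            else if (s < n2)%N && (c2 s < K2)%N then (K1 + c2 s)%N else (K1 + K2)%N.
have nKc : admissible n (K1 + K2) c.
  move=> s s' sn s'n; rewrite /c.
  case: (B s); case: (B s'); (case: ifP => [/andP[? ?]|_]; last by rewrite ltnn);
    (case: ifP => [/andP[? ?]|_]; last by move=> -> ; rewrite ltnn) => cc _.
  - exact: a1.
  - by exfalso; lia.
  - by exfalso; lia.
  - by apply: a2 => //; lia.
apply: le_trans (ler_powRl (ltW p0) (colnorm_ge0 _ _ _ _) (colnorm_xnorm xX nKc)).
rewrite !pn_pow// big_split_ord/=; apply: lerD; apply: ler_sum => t _;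
    rewrite !ger0_norm ?nu_ge0//; apply: ler_powRl; rewrite ?nu_ge0 ?(ltW p0)//;
    apply: nu_le => [|s sn]; rewrite ?leq_maxl ?leq_maxr// /restr/=.
- rewrite /c; case: (B s); rewrite ?mulr0n ?eqxx// mulr1n => _ c1s.
  by rewrite sn c1s ltn_ord.
- rewrite /c; case: (B s); rewrite ?mulr0n ?eqxx// mulr1n => _ c2s.
  by rewrite sn c2s ltn_ord.
Qed.

Lemma xnorm_split B x : inX x ->
  xnorm (restr B x) `^ p + xnorm (restr (predC B) x) `^ p <= xnorm x `^ p.
Proof.
move=> xX.
have h n1 K1 c1 : admissible n1 K1 c1 -> colnorm n1 K1 c1 (restr B x) `^ p +
    xnorm (restr (predC B) x) `^ p <= xnorm x `^ p.
  move=> a1; rewrite -lerBrDl; apply: xnorm_powR_le; first exact: inX_restr.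
    rewrite subr_ge0; apply: le_trans (colnorm_split B xX a1 admissible0).
    by rewrite lerDl powR_ge0.
  by move=> n2 K2 c2 a2; rewrite lerBrDl; exact: colnorm_split.
rewrite -lerBrDr; apply: xnorm_powR_le; first exact: inX_restr.
  by rewrite subr_ge0; apply: le_trans (h _ _ _ admissible0); rewrite lerDr powR_ge0.
by move=> n K c nKc; rewrite lerBrDr; exact: h.
Qed.

(** A colouring that almost attains the norm sees only the indices below some [n], so the lower l^p
    estimate leaves little norm beyond [n]. Arbitrary parts [B] of the tail are allowed, which
    rearranged series require. *)
Lemma xnorm_tail x e : inX x -> 0 < e ->
  exists M, forall B, (forall s, B s -> (M <= s)%N) -> xnorm (restr B x) <= e.
Proof.
move=> xX e0.
have [x0|xn0] := eqVneq (xnorm x) 0.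
  by exists 0%N => B _; apply: le_trans (xnorm_restr B xX) _; rewrite x0 ltW.
have xp : 0 < xnorm x by rewrite lt_def xn0 xnorm_ge0.
have [xe|ex] := leP (xnorm x) e.
  by exists 0%N => B _; apply: le_trans (xnorm_restr B xX) xe.
(* Chosen so that w^p + e^p is the p-th power of the norm of [x]. *)
pose w := (xnorm x `^ p - e `^ p) `^ p^-1.
have ep : 0 <= xnorm x `^ p - e `^ p.
  by rewrite subr_ge0 ler_powRl// ltW.
have wx : w < xnorm x.
  rewrite ltNge -(@ler_powR_iff _ p) ?powR_ge0 ?(ltW xp)// powRVK ?gt_eqF//.
  by rewrite -ltNge ltrBlDr ltrDl powR_gt0.
have [n [K [c [nKc]]]] := xnorm_approx xX (eqbRL (subr_gt0 _ _) wx).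
rewrite subKr => wV; exists n => B Bn.
rewrite -(@ler_powR_iff _ p) ?(ltW e0)//; last by apply: xnorm_ge0; exact: inX_restr.
have := xnorm_split B xX; rewrite -lerBrDr => /le_trans; apply.
rewrite lerBlDr -lerBlDl.
have -> : xnorm x `^ p - e `^ p = w `^ p by rewrite powRVK// gt_eqF.
apply: ler_powRl; rewrite ?(ltW p0) ?powR_ge0//.
apply: le_trans (ltW wV) _.
apply: le_trans (colnorm_xnorm (inX_restr _ xX) nKc).
apply: colnorm_le => s sn; rewrite /restr /=.
case: (boolP (B s)) => [/Bn|_]; last by rewrite mulr1n.
by rewrite leqNgt sn.
Qed.

(** * Linear combinations of block vectors *)

Section Blocks.
Variables (L : nat -> nat) (v : nat -> nat -> R).
Hypothesis L_mono : forall i j, (i <= j)%N -> (L i <= L j)%N.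
Hypothesis v_supp : forall j s, v j s != 0 -> (L j <= s < L j.+1)%N.

Lemma block_eq s j j' : v j s != 0 -> (L j' <= s < L j'.+1)%N -> j = j'.
Proof.
move=> /v_supp/andP[a b] /andP[a' b'].
case: (ltngtP j j') => // h; have := L_mono h; lia.
Qed.

Lemma comb_single s j J a : v j s != 0 -> (j < J)%N -> comb J a v s = a j * v j s.
Proof.
move=> vjs jJ; rewrite /comb (bigD1 (Ordinal jJ))//= big1 ?addr0// => i ij.
have [->|vis] := eqVneq (v i s) 0; first by rewrite mulr0.
case/negP: ij; apply/eqP/val_inj => /=.
by apply: block_eq vis (v_supp vjs).
Qed.

Lemma comb_powR J a s : `|comb J a v s| `^ p = \sum_(j < J) `|a j * v j s| `^ p.
Proof.
have [[j jJ] /= vjs|v0] := pickP (fun j : 'I_J => v j s != 0).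
  rewrite (comb_single _ vjs jJ) (bigD1 (Ordinal jJ))//= big1 ?addr0// => i ij.
  have [->|vis] := eqVneq (v i s) 0; first by rewrite mulr0 normr0 powR0// gt_eqF.
  case/negP: ij; apply/eqP/val_inj => /=.
  by apply: block_eq vis (v_supp vjs).
rewrite /comb !big1 ?normr0 ?powR0 ?gt_eqF// => j _; have := v0 j => /= /negbFE /eqP ->.
  by rewrite mulr0 normr0 powR0// gt_eqF.
by rewrite mulr0.
Qed.

(** If [s] lies in a later block than [s'], then [r s] is at least the start of that block, hence
    above [s'], which admissibility forbids. So each colour sees a single block. *)
Lemma diag_bounded J a : (forall j, inX (v j)) ->
  (forall j s, v j s != 0 -> (L j <= r s)%N) ->
  bounded_by (comb J a v) (pn p J (fun j => a j * xnorm (v j))).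
Proof.
move=> vX v_diag n K c nKc; rewrite pn_le_pow ?pn_ge0// pn_pow//.
have nu_comb (t : 'I_K) : nu n c t (comb J a v) `^ p <=
    \sum_(j < J) nu n c t (fun s => a j * v j s) `^ p.
  have [[j s] /= /andP[vjs /eqP cst]|none] :=
      pickP (fun js : 'I_J * 'I_n => (v js.1 js.2 != 0) && (c js.2 == t)).
    rewrite (bigD1 j)//=; apply: ler_wpDr; first by apply: sumr_ge0 => *; exact: powR_ge0.
    apply: ler_powRl; rewrite ?(ltW p0) ?nu_ge0//.
    apply: nu_le => // s' s'n combs' cs't; split=> //.
    suff -> : comb J a v s' = a j * v j s' by [].
    rewrite /comb (bigD1 j)//= big1 ?addr0// => i ij.
    have [->|vis'] := eqVneq (v i s') 0; first by rewrite mulr0.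
    case/negP: ij; apply/eqP/val_inj => /=.
    (* Admissibility is taken in both orders, since either of the two blocks may be the later
       one. *)
    have ss' := nKc _ _ (ltn_ord s) s'n (etrans cst (esym cs't)).
    have s's := nKc _ _ s'n (ltn_ord s) (etrans cs't (esym cst)).
    rewrite cst ltn_ord in ss'; rewrite cs't ltn_ord in s's.
    have := v_supp vjs; have := v_supp vis'; have := v_diag _ _ vjs; have := v_diag _ _ vis'.
    have := ss' isT; have := s's isT.
    case: (ltngtP i j) => // h; have := L_mono h; lia.
  have -> : nu n c t (comb J a v) = 0.
    rewrite -(@pn0 _ q n)//; apply: eq_pn => i _; congr `|_|.
    rewrite -(@pn0 _ p n)//; apply: eq_pn => s sn; congr `|_|.
    have [cst|] := eqVneq (c s) t; last by rewrite mulr0n.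
    rewrite (_ : comb J a v s = 0) ?mul0rn// /comb big1// => j _.
    have := none (j, Ordinal sn); rewrite /= cst eqxx andbT => /negbFE/eqP ->.
    by rewrite mulr0.
  by rewrite powR0 ?gt_eqF//; apply: sumr_ge0 => *; exact: powR_ge0.
apply: le_trans (_ : \sum_(t < K) \sum_(j < J) nu n c t (fun s => a j * v j s) `^ p <= _).
  by apply: ler_sum => t _; rewrite ger0_norm ?nu_ge0.
rewrite exchange_big; apply: ler_sum => j _.
apply: le_trans (_ : colnorm n K c (fun s => a j * v j s) `^ p <= _).
  by rewrite pn_pow//; apply: ler_sum => t _; rewrite ger0_norm ?nu_ge0.
apply: ler_powRl; rewrite ?(ltW p0) ?colnorm_ge0//.
rewrite colnormZ normrM ler_wpM2l// (le_trans (colnorm_xnorm (vX j) nKc))// ler_norm//.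
Qed.

(** Within a row the disjoint blocks add up in l^p, so the row norms of the combination are at most
    the l^p norm of [a] times [g]; then the l^q sum over the rows is taken. *)
Lemma rows_bounded J a (g : nat -> R) G :
  (forall j n (i : nat), rownorm n (v j) i <= g i) -> (forall n, pn q n g <= G) ->
  bounded_by (comb J a v) (pn p J a * G).
Proof.
move=> vg gG n K c _; apply: le_trans (colnorm_rows _ _ _ _) _.
apply: le_trans (ler_wpM2l (pn_ge0 _ _ _) (gG n)).
rewrite -[X in _ <= X * _]ger0_norm ?pn_ge0// -pnZ//; apply: ler_pn => // i _.
have g0 : 0 <= g i by apply: le_trans (vg 0%N 0%N i); exact: pn_ge0.
rewrite !ger0_norm ?mulr_ge0 ?pn_ge0// pn_le_pow ?mulr_ge0 ?pn_ge0//.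
rewrite powRM ?pn_ge0// pn_pow//.
apply: le_trans (_ : \sum_(j < J) \sum_(s < n) `|a j| `^ p * `|v j s *+ (r s == i)| `^ p <= _).
  rewrite exchange_big; apply: ler_sum => s _.
  case: eqP => _; last by rewrite mulr0n normr0 powR0 ?gt_eqF// sumr_ge0// => j _; rewrite mulr_ge0 ?powR_ge0.
  rewrite mulr1n comb_powR; apply: ler_sum => j _.
  by rewrite normrM powRM.
rewrite mulr_suml; apply: ler_sum => j _; rewrite -mulr_sumr ler_wpM2l ?powR_ge0//.
by have := vg j n i; rewrite pn_le_pow.
Qed.

Lemma comb_inX J a : (forall j, inX (v j)) -> inX (comb J a v).
Proof.
move=> vX; elim: J => [|J IH].
  by rewrite (_ : comb 0 a v = fun=> 0); [exact: inX0|apply/funext => s; rewrite /comb big_ord0].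
rewrite (_ : comb J.+1 a v = fun s => comb J a v s + a J * v J s).
  by apply: inXD => //; exact: inXZ.
by apply/funext => s; rewrite /comb big_ord_recr.
Qed.

(** Induction on [J]: [xnorm_split] at [L J] cuts off the last block. *)
Lemma block_lower J a : (forall j, inX (v j)) ->
  pn p J (fun j => a j * xnorm (v j)) <= xnorm (comb J a v).
Proof.
move=> vX; rewrite pn_le_pow ?xnorm_ge0//; last exact: comb_inX.
elim: J => [|J IH]; first by rewrite big_ord0 powR_ge0.
rewrite big_ord_recr/=.
apply: le_trans (xnorm_split (fun s => (s < L J)%N) (comb_inX J.+1 a vX)).
apply: lerD.
  rewrite (_ : restr _ _ = comb J a v)//; apply/funext => s.
  rewrite /restr /comb big_ord_recr /=; case: ltnP => h.
    have [->|/v_supp] := eqVneq (v J s) 0; first by rewrite mulr0 addr0.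
    by rewrite leqNgt h.
  rewrite mulr0n big1// => i _; have [->|/v_supp] := eqVneq (v i s) 0; first by rewrite mulr0.
  have := L_mono (ltn_ord i); lia.
rewrite normrM [X in _ * X](ger0_norm (xnorm_ge0 (vX J))) -(xnormZ _ (vX J)).
rewrite le_eqVlt; apply/orP; left; apply/eqP; congr (_ `^ _); apply: eq_xnorm => s.
rewrite /restr /comb big_ord_recr /=; case: ltnP => h.
  have [->|/v_supp] := eqVneq (v J s) 0; first by rewrite mulr0 mulr0n.
  by rewrite leqNgt h.
rewrite mulr1n big1 ?add0r// => i _; have [->|/v_supp] := eqVneq (v i s) 0; first by rewrite mulr0.
have := L_mono (ltn_ord i); lia.
Qed.

End Blocks.
End PlegmaNorm.

(** * Block decompositions of bounded sequences *)

Lemma mulrb_le (R : realType) (x : R) (b : bool) : `|x *+ b| <= `|x|.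
Proof. by case: b; rewrite ?mulr1n// mulr0n normr0. Qed.

(** * Limits along a nonprincipal ultrafilter *)

Section UltraLimit.
Variable R : realType.

(** One ultrafilter replaces the diagonal extraction of subsequences: the limits of all coordinates
    and of all row norms exist along it at once. *)
Lemma nat_ultrafilter : exists U : set_system nat,
  UltraFilter U /\ forall N, U [set n | (N <= n)%N].
Proof.
have [U [UU sU]] := ultraFilterLemma (F := (\oo : set_system nat)) _.
by exists U; split=> // N; apply: sU; exists N.
Qed.

(** Compactness of [[-b, b]] gives a cluster point, and a cluster point of an ultrafilter is a
    limit, since otherwise the complement of the set would belong to [U]. *)
Lemma ultra_limit (U : set_system nat) (g : nat -> R) (b : R) : UltraFilter U ->
  (forall n, `|g n| <= b) -> exists l : R, forall e : R, 0 < e -> U [set n | `|g n - l| <= e].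
Proof.
move=> UU gb; have PF : ProperFilter (g @ U) by apply: fmap_proper_filter.
have Uab : (g @ U) `[- b, b]%classic.
  by apply: (@filterS _ U _ setT) => [n _ /=|]; [rewrite in_itv/= -ler_norml|exact: filterT].
have [l [_ ll]] := segment_compact PF Uab.
exists l => e e0; have [//|UC] := in_ultra_setVsetC [set n | `|g n - l| <= e] UU.
have [y [/= ny yb]] := ll (g @` ~` [set n | `|g n - l| <= e]) (ball l e)
  (filterS (@preimage_image _ _ g _) UC) (nbhsx_ballx l e e0).
case: ny yb => n /= /negP nle <-; rewrite /ball /= distrC => /ltW.
by move=> h; rewrite h in nle.
Qed.

End UltraLimit.

Lemma half_exp_sum (R : realType) n : \sum_(i < n) (2^-1 : R) ^+ i <= 2.
Proof.
suff -> : \sum_(i < n) (2^-1 : R) ^+ i = 2 - 2 * 2^-1 ^+ n.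
  by rewrite lerBlDr lerDl mulr_ge0// exprn_ge0.
elim: n => [|n IH]; first by rewrite big_ord0 expr0 mulr1 subrr.
by rewrite big_ord_recr/= IH exprS; field.
Qed.

(** * Extraction of an almost block subsequence *)

Section BlockDecomposition.
Variables (R : realType) (p q : R) (r : nat -> nat).
Hypothesis (q1 : 1 < q) (qp : q < p) (r_le : forall s, (r s <= s)%N).
Notation inX := (inX p q r).
Notation xnorm := (xnorm p q r).
Notation bounded_by := (bounded_by p q r).
Notation rownorm := (rownorm p r).

Let p1 : 1 < p. Proof. exact: lt_trans qp. Qed.
Let p0 : 0 < p. Proof. exact: lt_trans p1. Qed.
Let q0 : 0 < q. Proof. exact: lt_trans q1. Qed.
Implicit Types (y z : nat -> R).

Lemma sum_restr_le (F : nat -> R) n m : (forall s, 0 <= F s) ->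
  \sum_(s < n) F s *+ (s < m)%N <= \sum_(s < m) F s.
Proof.
move=> F0; apply: le_trans (_ : \sum_(s < maxn n m) F s *+ (s < m)%N <= _).
  rewrite (big_ord_widen _ (fun s => F s *+ (s < m)%N) (leq_maxl n m)).
  rewrite [leRHS](bigID (fun s : 'I__ => (s < n)%N))/= lerDl.
  by apply: sumr_ge0 => s _; exact: mulrn_wge0.
rewrite (big_ord_widen _ F (leq_maxr n m)) [leRHS]big_mkcond/=.
by apply: ler_sum => s _; case: ifP => _; rewrite ?mulr1n ?mulr0n.
Qed.

Lemma pn_restr_le (e : R) n m y : 0 < e ->
  pn e n (restr (fun s => (s < m)%N) y) <= pn e m y.
Proof.
move=> e0; rewrite pn_le_pow ?pn_ge0// pn_pow//.
apply: le_trans (sum_restr_le n m (fun s => powR_ge0 `|y s| e)).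
apply: ler_sum => s _; rewrite /restr; case: ltnP => _; rewrite ?mulr1n//.
by rewrite !mulr0n normr0 powR0// gt_eqF.
Qed.

Lemma head_bounded m y :
  bounded_by (restr (fun s => (s < m)%N) y) (\sum_(s < m) `|y s|).
Proof.
move=> n K c _; apply: le_trans (colnorm_pn q1 qp r_le _ _ _ _) _.
exact: le_trans (pn_restr_le _ _ _ q0) (ler_pn_l1 _ _ (ltW q1)).
Qed.

(** A row is an admissible set: if [r s = r s'] then [r s <= s']. The length [m] is large enough for
    row [i] to be among the rows that are summed. *)
Lemma rownorm_le_xnorm n y i : inX y -> rownorm n y i <= xnorm y.
Proof.
move=> yX; pose m := maxn n i.+1; pose A := [pred s | r s == i].
apply: le_trans (@class_le_xnorm _ p q r q1 qp m A y yX _); last first.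
  by move=> s s' _ _ /eqP -> /eqP <-.
apply: le_trans (_ : `|rownorm m (restr A y) i| <= _); last first.
  by apply: ler_pn_coord => //; rewrite leq_max ltnSn orbT.
rewrite ger0_norm ?pn_ge0//; apply: ler_pn_widen => //; first exact: leq_maxl.
by move=> s _; rewrite /restr /=; case: (r s == i); rewrite ?mulr1n ?mulr0n ?mul0rn.
Qed.

Lemma rownormD n y z i :
  rownorm n (fun s => y s + z s) i <= rownorm n y i + rownorm n z i.
Proof.
by apply: le_trans (ler_pnD _ _ _ p1); apply: ler_pn => // s _; rewrite mulrnDl.
Qed.

(** The indices [s >= m] in rows below [m] form an admissible set, so there the l^q sum of the row
    norms is at most the norm. The first [m] coordinates give the error term, which is small for
    coordinatewise null sequences. *)
Lemma low_rows_le m n y : inX y ->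
  pn q m (rownorm n y) <= xnorm y + m%:R * \sum_(s < m) `|y s|.
Proof.
move=> yX; pose hi := restr (fun s => (m <= s)%N) y.
pose lo := restr (fun s => (s < m)%N) y.
apply: le_trans (_ : pn q m (fun i => rownorm n hi i + \sum_(s < m) `|y s|) <= _).
  apply: ler_pn => // i _; rewrite !ger0_norm ?pn_ge0 ?addr_ge0 ?pn_ge0 ?sumr_ge0//.
  have {1}-> : y = fun s => hi s + lo s.
    by apply/funext => s; rewrite /hi /lo /restr; case: ltnP; rewrite ?addr0 ?add0r.
  apply: le_trans (rownormD _ _ _ _) _; rewrite lerD2l.
  apply: le_trans (_ : pn p n lo <= _).
    by apply: ler_pn => // s _; case: eqP => _; rewrite ?mulr1n// mulr0n normr0.
  exact: le_trans (pn_restr_le _ _ _ p0) (ler_pn_l1 _ _ (ltW p1)).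
apply: le_trans (ler_pnD _ _ _ q1) _; apply: lerD; last first.
  apply: le_trans (ler_pn_l1 _ _ (ltW q1)) _.
  by rewrite sumr_const card_ord mulr_natl ger0_norm// sumr_ge0.
pose N := maxn n m; pose A := [pred s | (r s < m)%N && (m <= s)%N].
apply: le_trans (@class_le_xnorm _ p q r q1 qp N A y yX _); last first.
  by move=> s s' _ _ /andP[/ltnW a _] /andP[_]; exact: leq_trans.
apply: ler_pn_widen => //; first exact: leq_maxr.
move=> i im; rewrite !ger0_norm ?pn_ge0//.
apply: ler_pn_widen => //; first exact: leq_maxl.
move=> s _; rewrite /hi /restr /=; case: eqP => [->|_]; last by rewrite !mulr0n.
by rewrite im.
Qed.

(** The subsequence [x (sigma j)] is [z] plus a block [v j] plus an error of size 2 * 2^-j. The last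
    clause is the upper l^p estimate for the blocks. *)
Definition block_decomposition (x : nat -> nat -> R) (sigma : nat -> nat) z
    (L : nat -> nat) (v : nat -> nat -> R) (D : R) : Prop :=
  [/\ [/\ inX z, forall j, (sigma j < sigma j.+1)%N & 0 <= D],
      (forall i j, (i <= j)%N -> (L i <= L j)%N) /\ (forall j, (j <= L j)%N),
      forall j s, v j s != 0 -> (L j <= s < L j.+1)%N,
      forall j, [/\ inX (v j), xnorm (v j) <= D &
        bounded_by (fun s => x (sigma j) s - z s - v j s) (2 * 2^-1 ^+ j)]
    & forall J a, bounded_by (comb J a v) (pn p J a * D)].

Section Selection.
Variables (U : set_system nat) (UU : UltraFilter U).
Hypothesis UN : forall N, U [set n | (N <= n)%N].

Lemma ultra_sum (F : nat -> nat -> R) m :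
  (forall s e, 0 < e -> U [set n | `|F n s| <= e]) ->
  forall e, 0 < e -> U [set n | \sum_(s < m) `|F n s| <= e].
Proof.
move=> UF; elim: m => [|m IH] e e0.
  by apply: filterS filterT => n _ /=; rewrite big_ord0 ltW.
have e2 : 0 < e / 2 by rewrite divr_gt0.
apply: filterS (filterI (IH _ e2) (UF m _ e2)) => n [/= a b].
by rewrite big_ord_recr/= [e]splitr lerD.
Qed.

Lemma ultra_forall (P : nat -> nat -> Prop) m :
  (forall i, (i < m)%N -> U [set n | P i n]) ->
  U [set n | forall i, (i < m)%N -> P i n].
Proof.
elim: m => [|m IH] UP; first by apply: filterS filterT => n _ i.
have h := IH (fun i im => UP i (ltnW im)).
apply: filterS (filterI h (UP m (ltnSn m))) => n [/= a b] i.
by rewrite ltnS leq_eqVlt => /predU1P[->//|]; exact: a.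
Qed.

End Selection.

Lemma block_decomposition_exists (x : nat -> nat -> R) B :
  (forall n, bounded_by (x n) B) ->
  exists sigma z L v D, block_decomposition x sigma z L v D.
Proof.
move=> xB; have xX n : inX (x n) by exists B; exact: xB.
have xnB n : xnorm (x n) <= B by exact: bounded_xnorm (xB n).
have [U [UU UN]] := nat_ultrafilter.
(* [z] is the coordinatewise limit along [U], and [u n] below is the coordinatewise null
   remainder. *)
have /choice[z zP] : forall s, exists l : R, forall e : R, 0 < e -> U [set n | `|x n s - l| <= e].
  move=> s; apply: (@ultra_limit _ _ _ B) => n.
  by apply: le_trans (xnB n); apply: xnorm_coord (xX n).
have zB : bounded_by z B.
  move=> n K c nKc; apply/ler_addgt0Pr => e e0.
  have [m /= me] := filter_ex (ultra_sum UU n zP e0).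
  rewrite (_ : z = fun s => x m s + (z s - x m s)); last first.
    by apply/funext => s; rewrite addrC subrK.
  apply: le_trans (colnormD _ q1 qp _ _ _ _ _) _; apply: lerD; first exact: xB.
  apply: le_trans (colnorm_l1 q1 qp r_le _ _ _ _) _; apply: le_trans me.
  by apply: ler_sum => s _; rewrite distrC.
have zX : inX z by exists B.
have B0 : 0 <= B by apply: le_trans (xnB 0%N); exact: xnorm_ge0 (xX _).
pose u n s := x n s - z s.
pose D0 := B + B.
have uB n : bounded_by (u n) D0.
  apply: (boundedD q1 qp (xB n)) => m K c mKc; apply: le_trans (zB m K c mKc).
  by apply: colnorm_le => // s _; rewrite normrN.
have uX n : inX (u n) by exists D0; exact: uB.
have unB n : xnorm (u n) <= D0 by exact: bounded_xnorm (uB n).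
have /choice[M MP] : forall n, exists M, forall A : pred nat,
    (forall s, A s -> (M <= s)%N) -> xnorm (restr A (u n)) <= 2^-1 ^+ n.
  by move=> n; apply: (xnorm_tail q1 qp (uX n)); rewrite exprn_gt0// invr_gt0.
pose rho n i := rownorm (M n) (u n) i.
(* [f i] is the limit of the norms of row [i]; it will be the common l^q majorant of the row norms
   up to a summable error. *)
have /choice[f fP] : forall i, exists l : R, forall e : R, 0 < e -> U [set n | `|rho n i - l| <= e].
  move=> i; apply: (@ultra_limit _ _ _ D0) => n.
  rewrite ger0_norm ?pn_ge0//; apply: le_trans (unB n).
  exact: rownorm_le_xnorm.
have f0 i : 0 <= f i.
  apply/ler_addgt0Pr => e e0; have [n /= ne] := filter_ex (fP i e e0).
  apply: le_trans (pn_ge0 p (M n) (fun s => u n s *+ (r s == i))) _.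
  by rewrite -lerBlDl; apply: le_trans (ler_norm _) ne.
(* By [low_rows_le] the first [m] row norms of [u n] are bounded in l^q up to a head that vanishes
   along [U]. *)
have fD m : pn q m f <= D0.
  apply/ler_addgt0Pr => e e0.
  have e1 : 0 < e / 2 by rewrite divr_gt0.
  (* [low_rows_le] multiplies the head by [m]; the successor keeps the divisor nonzero. *)
  have e2 : 0 < e / 2 / m.+1%:R by rewrite divr_gt0// ltr0n.
  have [n [/= h1 h2]] := filter_ex (filterI (ultra_sum UU m fP e1) (ultra_sum UU m zP e2)).
  apply: le_trans (_ : pn q m (fun i => rho n i + (f i - rho n i)) <= _).
    by apply: ler_pn => // i _; rewrite addrC subrK.
  apply: le_trans (ler_pnD _ _ _ q1) _; rewrite [e]splitr addrA; apply: lerD; last first.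
    apply: le_trans (ler_pn_l1 _ _ (ltW q1)) _; apply: le_trans h1.
    by apply: ler_sum => i _; rewrite distrC.
  apply: le_trans (low_rows_le _ _ (uX n)) _; apply: lerD; first exact: unB.
  apply: le_trans (ler_wpM2l (ler0n _ _) h2) _.
  rewrite mulrCA ger_pMr// ler_pdivrMr ?ltr0n// mul1r ler_nat//.
pose g i := f i + 2^-1 ^+ i.
have g0 i : 0 <= g i by rewrite addr_ge0// exprn_ge0// invr_ge0.
have gG m : pn q m g <= D0 + 2.
  apply: le_trans (ler_pnD _ _ _ q1) _; apply: lerD; first exact: fD.
  apply: le_trans (ler_pn_l1 _ _ (ltW q1)) _; apply: le_trans (half_exp_sum R m).
  by apply: ler_sum => i _; rewrite ger0_norm// exprn_ge0// invr_ge0.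
have half0 i : 0 < (2^-1 : R) ^+ i by rewrite exprn_gt0// invr_gt0.
(* Given a start [LN.1] of a block and the last chosen index [LN.2], a later index is chosen whose
   first [LN.1] coordinates are small and whose row norms below [LN.1] are within 2^-i of [f i],
   hence below [g i]. *)
have /choice[nxt nxtP] : forall LN : nat * nat, exists n, [/\ (LN.2 < n)%N,
    \sum_(s < LN.1) `|u n s| <= 2^-1 ^+ LN.1 &
    forall i, (i < LN.1)%N -> `|rho n i - f i| <= 2^-1 ^+ i].
  move=> [l N] /=.
  have h1 := ultra_sum UU l zP (half0 l).
  have h2 := @ultra_forall U UU (fun i n => `|rho n i - f i| <= 2^-1 ^+ i) l
    (fun i _ => fP i _ (half0 i)).
  by have [n [/= a [b c]]] := filter_ex (filterI (UN N.+1) (filterI h1 h2)); exists n.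
(* The state is (L_j, sigma_j). The next block starts past [M (sigma j)], where the tail of the
   current vector is negligible. *)
pose st j := iter j (fun LN : nat * nat => let L' := maxn (M LN.2) LN.1.+1 in
  (L', nxt (L', LN.2))) (0%N, nxt (0%N, 0%N)).
pose L j := (st j).1; pose sigma j := (st j).2.
have LS j : L j.+1 = maxn (M (sigma j)) (L j).+1 by [].
have Lj j : (j <= L j)%N.
  by elim: j => // j IH; rewrite LS leq_max ltnS IH orbT.
have L_mono i j : (i <= j)%N -> (L i <= L j)%N.
  elim: j => [|j IH]; first by rewrite leqn0 => /eqP->.
  rewrite leq_eqVlt => /predU1P[->//|]; rewrite ltnS => /IH h.
  by apply: leq_trans h _; rewrite LS leq_max leqnSn orbT.
have good j : \sum_(s < L j) `|u (sigma j) s| <= 2^-1 ^+ L j /\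
    forall i, (i < L j)%N -> `|rho (sigma j) i - f i| <= 2^-1 ^+ i.
  by case: j => [|j]; [have [] := nxtP (0, 0)%N
    | have [] := nxtP (L j.+1, sigma j)].
have sig_inc j : (sigma j < sigma j.+1)%N by have [] := nxtP (L j.+1, sigma j).
have sigj j : (j <= sigma j)%N.
  by elim: j => // j IH; apply: leq_ltn_trans IH (sig_inc j).
pose v j := restr (fun s => (L j <= s < M (sigma j))%N) (u (sigma j)).
have vX j : inX (v j) by exact: inX_restr (uX _).
have vD j : xnorm (v j) <= D0 by apply: le_trans (unB (sigma j)); apply: xnorm_restr (uX _).
have v_supp j s : v j s != 0 -> (L j <= s < L j.+1)%N.
  rewrite /v /restr; case: (boolP (_ <= s < _)%N); last by rewrite mulr0n eqxx.
  by move=> /andP[-> h] _; rewrite LS leq_max h.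
(* [D0 + 2] bounds the part in the rows below [L j], and [D0] the part in the other rows. *)
exists sigma, z, L, v, (D0 + 2 + D0); split=> //.
- by split=> //; rewrite !addr_ge0.
- move=> j; split=> //; first by apply: le_trans (vD j) _; rewrite lerDr !addr_ge0.
  (* The error is the head before [L j] and the tail from [M (sigma j)] on; the tail is cut at [L j]
     as well, since [M (sigma j)] may be smaller. *)
  have -> : (fun s => x (sigma j) s - z s - v j s) =
     fun s => restr (fun s => (s < L j)%N) (u (sigma j)) s +
       restr (fun s => (L j <= s)%N && (M (sigma j) <= s)%N) (u (sigma j)) s.
    apply/funext => s; rewrite /v /restr -/(u (sigma j) s).
    by case: ltnP => _; case: ltnP => _ /=; rewrite ?mulr1n ?mulr0n ?subr0 ?addr0 ?add0r ?subrr.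
  rewrite mulr2n mulrDl mul1r.
  apply: boundedD => // n K c nKc.
    apply: le_trans (head_bounded _ _ nKc) _.
    apply: le_trans (good j).1 _; apply: ler_wiXn2l (Lj j); rewrite ?invr_ge0//.
    by rewrite invf_le1// ler1n.
  apply: le_trans (_ : xnorm (restr (fun s => (L j <= s)%N && (M (sigma j) <= s)%N)
    (u (sigma j))) <= _).
    by apply: colnorm_xnorm nKc; apply: (inX_restr q1 qp _ (uX _)).
  apply: le_trans (MP (sigma j) _ _) _; first by move=> s /andP[].
  by apply: ler_wiXn2l (sigj j); rewrite ?invr_ge0// invf_le1// ler1n.
move=> J a.
(* Splitting by rows: [rows_bounded] with majorant [g] applies to [y], and [diag_bounded] applies to
   [w]. *)
pose y j := restr (fun s => (r s < L j)%N) (v j).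
pose w j := restr (fun s => (L j <= r s)%N) (v j).
have y_supp j s : y j s != 0 -> (L j <= s < L j.+1)%N.
  by move=> h; apply: v_supp; apply: contraNneq h; rewrite /y /restr => ->; rewrite mul0rn.
have w_supp j s : w j s != 0 -> (L j <= s < L j.+1)%N.
  by move=> h; apply: v_supp; apply: contraNneq h; rewrite /w /restr => ->; rewrite mul0rn.
rewrite (_ : comb J a v = fun s => comb J a y s + comb J a w s); last first.
  apply/funext => s; rewrite /comb -big_split/=; apply: eq_bigr => j _.
  by rewrite -mulrDr /y /w /restr; case: ltnP => _; rewrite ?mulr1n ?mulr0n ?addr0 ?add0r.
rewrite mulrDr; apply: boundedD => //.
  have rowsb := rows_bounded q1 qp L_mono y_supp.
  apply: (rowsb r J a g (D0 + 2)) => // j n i.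
  have [iL|iL] := ltnP i (L j); last first.
    apply: le_trans (g0 i); rewrite -(@pn0 _ p n)//; apply: ler_pn => // s _.
    rewrite /y /restr; case: eqP => [->|_]; last by rewrite !mulr0n.
    by rewrite ltnNge iL mulr0n.
  apply: le_trans (_ : rho (sigma j) i <= _); last first.
    by rewrite -lerBlDl; apply: le_trans (ler_norm _) _; exact: (good j).2.
  apply: le_trans (pn_restr_le n (M (sigma j)) (fun s => u (sigma j) s *+ (r s == i)) p0).
  apply: ler_pn => // s _; rewrite /y /v /restr.
  case: (s < M _)%N; rewrite ?andbF ?mulr0n ?mul0rn//.
  case: (r s == i); last by rewrite !mulr0n mul0rn.
  by rewrite !mulr1n; apply: le_trans (mulrb_le _ _) (mulrb_le _ _).
have wX j : inX (w j) by apply: inX_restr (vX _).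
have w_diag j s : w j s != 0 -> (L j <= r s)%N.
  by rewrite /w /restr; case: (leqP (L j)) => //=; rewrite mulr0n eqxx.
have diagb := @diag_bounded _ p q r q1 qp.
move=> n K c nKc; apply: le_trans (diagb _ _ L_mono w_supp _ _ wX w_diag n K c nKc) _.
rewrite mulrC -[X in X * _](@ger0_norm _ D0) ?addr_ge0// -pnZ//.
apply: ler_pn => // j _; rewrite !normrM mulrC ler_wpM2r//.
rewrite ger0_norm; last exact: xnorm_ge0 (wX _).
apply: le_trans (_ : D0 <= _); last exact: ler_norm.
by apply: le_trans (vD j); apply: xnorm_restr (vX _).
Qed.

End BlockDecomposition.

(** * Spreading models in subspaces of X *)

Lemma sum_ord2 (V : zmodType) (F : nat -> V) : \sum_(i < 2) F i = F 0%N + F 1%N.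
Proof. by rewrite !big_ord_recr big_ord0 /= add0r. Qed.

Lemma sum_average (F : numFieldType) K : (0 < K)%N ->
  \sum_(i < K) (K%:R : F)^-1 = 1.
Proof.
by move=> K0; rewrite sumr_const card_ord -[LHS]mulr_natr mulVf// pnatr_eq0 -lt0n.
Qed.

Section SpreadingModels.
Variable R : realType.

(** Rescaling removes the restriction of the coefficients to [[-1, 1]], and starting far out removes
    the bound on the number of terms. *)
Lemma generates_sm_approx (Y E : normedModType R) (y : nat -> Y) (e : nat -> E) :
  generates_sm y e -> forall J (a : nat -> R) eps, 0 < eps ->
  exists l, forall n : nat -> nat, (forall i j, (i < j)%N -> (n i < n j)%N) ->
    (l <= n 0)%N ->
    `| `|\sum_(i < J) a i *: y (n i)| - `|\sum_(i < J) a i *: e i| | <= eps.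
Proof.
move=> [d [d0 dcvg] gen] [|J] a eps eps0.
  by exists 0%N => n _ _; rewrite !big_ord0 !normr0 subrr normr0 ltW.
pose A := 1 + \sum_(i < J.+1) `|a i|.
have sa : 0 <= \sum_(i < J.+1) `|a i| by apply: sumr_ge0 => i _; exact: normr_ge0.
have A0 : 0 < A by rewrite ltr_pwDl.
have aA i : (i < J.+1)%N -> `|a i| <= A.
  move=> iJ; rewrite /A (bigD1 (Ordinal iJ))//= addrCA lerDl addr_ge0//.
  by apply: sumr_ge0 => k _; exact: normr_ge0.
have [N _ Nd] : \forall n \near \oo, d n <= eps / A.
  move/cvgrPdist_le: dcvg => /(_ (eps / A) (divr_gt0 eps0 A0)).
  by apply: filterS => n /=; rewrite sub0r normrN; apply: le_trans; exact: ler_norm.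
exists (maxn N J) => n n_inc; rewrite geq_max => /andP[Nn Jn].
pose b (i : 'I_J.+1) := A^-1 * a i.
have h := gen J (fun i : 'I_J.+1 => n i) b.
have /h {h} : increasing_tuple (fun i : 'I_J.+1 => n i) by move=> i j; exact: n_inc.
have bE (V : normedModType R) (f : 'I_J.+1 -> V) :
    \sum_(i < J.+1) b i *: f i = A^-1 *: \sum_(i < J.+1) a i *: f i.
  by rewrite scaler_sumr; apply: eq_bigr => i _; rewrite scalerA.
rewrite !bE !normrZ -mulrBr normrM normr_id normfV (gtr0_norm A0) => h.
have {h}/ltW : A^-1 * `| `|\sum_(i < J.+1) a i *: y (n i)| - `|\sum_(i < J.+1) a i *: e i| | < d (n 0).
  apply: h => // i; rewrite -ler_norml /b normrM normfV (gtr0_norm A0).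
  by rewrite ler_pdivrMl// mulr1 aA.
move=> /le_trans/(_ (Nd _ Nn)).
by rewrite mulrC ler_pM2r ?invr_gt0.
Qed.

Lemma converges_to_unit (E : normedModType R) (e : nat -> E) i :
  converges_to e (fun j => (j == i)%:R) (e i).
Proof.
apply: cvg_near_cst; exists i.+1 => // n /= ni.
rewrite (bigD1 (Ordinal ni))//= eqxx scale1r big1 ?addr0// => j ji.
have -> : (j == i :> nat) = false by apply: contraNF ji => /eqP ji; apply/eqP/val_inj.
by rewrite scale0r.
Qed.

Lemma schauder_basis_inj (E : normedModType R) (e : nat -> E) i j :
  schauder_basis e -> e i = e j -> i = j.
Proof.
move=> eb eij; have [a [_ aU]] := eb (e i).
have ai := aU _ (@converges_to_unit E e i).
have aj : a = fun k => (k == j)%:R by apply: aU; rewrite eij; exact: converges_to_unit.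
apply/eqP; have : (i == i)%:R = (i == j)%:R :> R.
  by rewrite -[LHS](congr1 (fun f => f i) ai) aj.
by rewrite eqxx; case: eqP => // _ /eqP; rewrite oner_eq0.
Qed.

(** Equivalence to the l^p basis in terms of the finite norm [pn]; [lp_equiv_ell] translates it into
    [equivalent_to_ell]. *)
Definition lp_equiv (p : R) (E : normedModType R) (e : nat -> E) : Prop :=
  exists c C : R, [/\ 0 < c, 0 < C & forall n (a : nat -> R),
    c * pn p n a <= `|\sum_(i < n) a i *: e i| <= C * pn p n a].

(** The l^p norm of an average of [K] unit vectors is K^(1/p - 1), which tends to 0 as p > 1. *)
Lemma pn_average_small (p : R) eps : 1 < p -> 0 < eps ->
  exists N, forall K, (N <= K)%N -> (0 < K)%N /\ pn p K (fun=> (K%:R : R)^-1) <= eps.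
Proof.
move=> p1 eps0; have p0 : 0 < p by lra.
have P0 : 0 < p - 1 by lra.
pose b : R := ((eps `^ p)^-1) `^ (p - 1)^-1.
exists (Num.bound b).+1 => K bK; have K0 : (0 < K)%N by apply: leq_trans bK.
have KR : 0 < K%:R :> R by rewrite ltr0n.
split=> //; rewrite pn_le_pow ?(ltW eps0)// sumr_const card_ord.
have ep : 0 < eps `^ p by exact: powR_gt0.
have bK' : b <= K%:R.
  have b0 : 0 <= b by exact: powR_ge0.
  apply: le_trans (ltW (archi_boundP b0)) _.
  by rewrite ler_nat; apply: leq_trans bK.
have h : (eps `^ p)^-1 <= K%:R `^ (p - 1).
  rewrite -[leLHS](@powRVK _ (p - 1)) ?gt_eqF ?invr_ge0 ?(ltW ep)//.
  by apply: ler_powRl => //; [exact: ltW|exact: powR_ge0].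
rewrite normfV (ger0_norm (ltW KR)) -(powR_inv1 (ltW KR)) powRAC powR_inv1 ?powR_ge0//.
rewrite -[X in X <= _]mulr_natl -(mulr_powRB1 (ltW KR) p0) invfM mulrA divff ?gt_eqF// mul1r.
by rewrite -[leRHS]invrK lef_pV2 ?posrE ?invr_gt0// powR_gt0.
Qed.

End SpreadingModels.

(** * Spreading models of spaces that embed in X *)

Section Embedded.
Variables (R : realType) (p q : R) (r : nat -> nat).
Hypothesis (q1 : 1 < q) (qp : q < p) (r_le : forall s, (r s <= s)%N).
Notation inX := (inX p q r).
Notation xnorm := (xnorm p q r).
Notation bounded_by := (bounded_by p q r).

Let p1 : 1 < p. Proof. exact: lt_trans qp. Qed.
Let p0 : 0 < p. Proof. exact: lt_trans p1. Qed.

(** An isomorphic embedding into X, where X is still described by [inX] and [xnorm] on functions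
    rather than as a bundled space. *)
Definition embedding (Y : normedModType R) (T : Y -> nat -> R) c C : Prop :=
  [/\ 0 < c, 0 < C, forall a u v s, T (a *: u + v) s = a * T u s + T v s
    & forall u, inX (T u) /\ c * `|u| <= xnorm (T u) <= C * `|u|].

Definition embeds (Y : normedModType R) : Prop :=
  exists (T : Y -> nat -> R) c C, embedding T c C.

Lemma embedding_sum (Y : normedModType R) (T : Y -> nat -> R) c C J
    (a : nat -> R) (w : nat -> Y) :
  embedding T c C -> T (\sum_(i < J) a i *: w i) = comb J a (fun i => T (w i)).
Proof.
move=> [_ _ Tlin _]; apply/funext => s; rewrite /comb.
elim: J => [|J IH]; last by rewrite !big_ord_recr/= addrC Tlin IH addrC.
rewrite !big_ord0; have := Tlin 1 0 0 s; rewrite scaler0 add0r mul1r.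
by move/eqP; rewrite -subr_eq subrr => /eqP <-.
Qed.

Lemma comb_bounded J a (f : nat -> nat -> R) (b : nat -> R) :
  (forall j, bounded_by (f j) (b j)) ->
  bounded_by (comb J a f) (\sum_(j < J) `|a j| * b j).
Proof.
move=> fb; elim: J => [|J IH].
  rewrite big_ord0 (_ : comb 0 a f = fun=> 0).
    by move=> n K c nKc; rewrite -[leRHS](xnorm0 q1 qp r_le); apply: colnorm_xnorm nKc; apply: inX0.
  by apply/funext => s; rewrite /comb big_ord0.
rewrite big_ord_recr/= (_ : comb J.+1 a f = fun s => comb J a f s + a J * f J s).
  apply: boundedD => // n K c nKc; rewrite colnormZ// ler_wpM2l//; exact: fb.
by apply/funext => s; rewrite /comb big_ord_recr.
Qed.

(** Coefficients preceded by [l] zeros, which carry estimates for the blocks from 0 on over to the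
    blocks from [l] on. *)
Definition shift_coef l (a : nat -> R) j := if (j < l)%N then 0 else a (j - l)%N.

Lemma comb_shift l J a (v : nat -> nat -> R) :
  comb (l + J) (shift_coef l a) v = comb J a (fun i => v (l + i)%N).
Proof.
apply/funext => s; rewrite /comb big_split_ord/= big1 ?add0r.
  by apply: eq_bigr => i _; rewrite /shift_coef ltnNge leq_addr/= addKn.
by move=> i _; rewrite /shift_coef ltn_ord mul0r.
Qed.

Lemma pn_shift l J a : pn p (l + J) (shift_coef l a) = pn p J a.
Proof.
rewrite !pnE big_split_ord/= big1 ?add0r.
  by congr (_ `^ _); apply: eq_bigr => i _; rewrite /shift_coef ltnNge leq_addr/= addKn.
by move=> i _; rewrite /shift_coef ltn_ord normr0 powR0// gt_eqF.
Qed.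

Section Decomposed.
Variables (x : nat -> nat -> R) (sigma : nat -> nat) (z : nat -> R).
Variables (L : nat -> nat) (v : nat -> nat -> R) (D : R).
Hypothesis dec : block_decomposition p q r x sigma z L v D.
Let err j s := x (sigma j) s - z s - v j s.

Lemma decomp_inc : forall i j, (i < j)%N -> (sigma i < sigma j)%N.
Proof. case: dec => -[_ h _] _ _ _ _; exact: (homo_ltn ltn_trans h). Qed.

Lemma decomp_ge j : (j <= sigma j)%N.
Proof. by elim: j => // j IH; apply: leq_ltn_trans IH (decomp_inc (ltnSn j)). Qed.

Lemma decomp_comb J l a : comb J a (fun i => x (sigma (l + i)%N)) =
  fun s => (\sum_(i < J) a i) * z s +
    (comb J a (fun i => v (l + i)%N) s + comb J a (fun i => err (l + i)%N) s).
Proof.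
apply/funext => s; rewrite /comb mulr_suml -!big_split/=.
by apply: eq_bigr => i _; rewrite /err; ring.
Qed.

(** Each |a j| is at most the l^p norm of [a], and the error sizes from index [l] on sum to at most
    4 * 2^-l. *)
Lemma decomp_err J l a :
  bounded_by (comb J a (fun i => err (l + i)%N)) (4 * 2^-1 ^+ l * pn p J a).
Proof.
case: dec => _ _ _ verr _ n K c nKc.
have errb j : bounded_by (err (l + j)%N) (2 * 2^-1 ^+ (l + j)%N) by case: (verr (l + j)%N).
apply: le_trans (comb_bounded J a errb nKc) _.
apply: le_trans (_ : \sum_(j < J) pn p J a * (2 * 2^-1 ^+ l * 2^-1 ^+ j) <= _).
  apply: ler_sum => j _; rewrite exprD mulrA ler_wpM2r//; exact: ler_pn_coord.
rewrite -mulr_sumr mulrC ler_wpM2r ?pn_ge0// -mulr_sumr.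
have h : 0 <= 2 * 2^-1 ^+ l :> R by rewrite mulr_ge0// exprn_ge0// invr_ge0.
apply: le_trans (ler_wpM2l h (half_exp_sum R J)) _.
by rewrite le_eqVlt; apply/orP; left; apply/eqP; ring.
Qed.

Lemma half_le1 l : (2^-1 : R) ^+ l <= 1.
Proof. by apply: exprn_ile1; rewrite ?invr_ge0// invf_le1// ler1n. Qed.

Lemma decomp_rest J l a : bounded_by
    (fun s => comb J a (fun i => v (l + i)%N) s + comb J a (fun i => err (l + i)%N) s)
    ((D + 4) * pn p J a).
Proof.
rewrite mulrDl; apply: boundedD => //.
  case: dec => _ _ _ _ /(_ (l + J)%N (shift_coef l a)).
  by rewrite comb_shift pn_shift mulrC.
move=> n K c nKc; apply: le_trans (@decomp_err J l a n K c nKc) _.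
by rewrite ler_wpM2r ?pn_ge0// ger_pMr ?half_le1.
Qed.

Lemma decomp_upper J l a : xnorm (comb J a (fun i => x (sigma (l + i)%N))) <=
  `|\sum_(i < J) a i| * xnorm z + (D + 4) * pn p J a.
Proof.
have [[zX _ _] _ _ _ _] := dec; rewrite decomp_comb; apply: bounded_xnorm.
apply: boundedD => //; last exact: decomp_rest.
by rewrite -(xnormZ q1 qp)//; apply: xnorm_bounded; exact: inXZ.
Qed.

Lemma decomp_mean J l a : inX (comb J a (fun i => x (sigma (l + i)%N))) ->
  `|\sum_(i < J) a i| * xnorm z <=
  xnorm (comb J a (fun i => x (sigma (l + i)%N))) + (D + 4) * pn p J a.
Proof.
move=> xX; have [[zX _ _] _ _ _ _] := dec; rewrite -(xnormZ q1 qp)//.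
have -> : (fun s => (\sum_(i < J) a i) * z s) = fun s =>
    comb J a (fun i => x (sigma (l + i)%N)) s + - 1 *
     (comb J a (fun i => v (l + i)%N) s + comb J a (fun i => err (l + i)%N) s).
  by rewrite decomp_comb; apply/funext => s; ring.
apply: bounded_xnorm; apply: boundedD => //; first exact: xnorm_bounded.
move=> n K c nKc; rewrite colnormZ// normrN1 mul1r.
exact: decomp_rest.
Qed.

(** Restriction to [s >= L l] does not increase the norm and keeps the blocks intact; of [z] only
    its tail remains. The lower estimate for blocks then applies up to this tail and the errors. *)
Lemma decomp_block_lower J l a d : 0 <= d ->
  inX (comb J a (fun i => x (sigma (l + i)%N))) ->
  (forall j, (l <= j)%N -> d <= xnorm (v j)) ->
  d * pn p J a <= xnorm (comb J a (fun i => x (sigma (l + i)%N))) +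
    (`|\sum_(i < J) a i| * xnorm (restr (fun s => (L l <= s)%N) z) +
     4 * 2^-1 ^+ l * pn p J a).
Proof.
move=> d0 xX dv; have [[zX _ _] [L_mono _] v_supp vX _] := dec.
have vlX j : inX (v (l + j)%N) by case: (vX (l + j)%N).
have shL i j : (i <= j)%N -> (L (l + i) <= L (l + j))%N.
  by move=> ij; apply: L_mono; rewrite leq_add2l.
have shS j s : v (l + j)%N s != 0 -> (L (l + j) <= s < L (l + j.+1))%N.
  by rewrite addnS; exact: v_supp.
apply: le_trans (_ : pn p J (fun j => a j * xnorm (v (l + j)%N)) <= _).
  rewrite -[d]ger0_norm// -pnZ//; apply: ler_pn => // j _.
  rewrite mulrC !normrM ler_wpM2l// ger0_norm// (le_trans _ (ler_norm _))//.
  exact: dv (leq_addr _ _).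
apply: le_trans (@block_lower _ p q r q1 qp r_le (fun i => L (l + i)%N) _ shL shS J a vlX) _.
pose B s := (L l <= s)%N.
have -> : comb J a (fun i => v (l + i)%N) = fun s =>
    restr B (comb J a (fun i => x (sigma (l + i)%N))) s +
    (- (\sum_(i < J) a i) * restr B z s +
     - 1 * restr B (comb J a (fun i => err (l + i)%N)) s).
  apply/funext => s; rewrite decomp_comb /restr /B; case: leqP => Ls.
    by rewrite !mulr1n; ring.
  rewrite !mulr0n !mulr0 !addr0 /comb big1// => i _.
  have [->|/shS/andP[]] := eqVneq (v (l + i)%N s) 0; first by rewrite mulr0.
  have := L_mono _ _ (leq_addr i l); lia.
apply: bounded_xnorm; apply: boundedD => //.
  apply: (bounded_mono q1 qp _ (xnorm_bounded xX)) => s; exact: restr_le.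
apply: boundedD => //.
  rewrite -[X in `|X|]opprK normrN -(xnormZ q1 qp); last exact: inX_restr.
  by apply: xnorm_bounded; apply: inXZ => //; exact: inX_restr.
move=> n K c nKc; rewrite colnormZ// normrN1 mul1r.
apply: le_trans (@decomp_err J l a n K c nKc); apply: colnorm_le => // s _; exact: restr_le.
Qed.

End Decomposed.

Lemma spreading_model_lp (Y : normedModType R) (E : completeNormedModType R)
    (w : nat -> Y) (e : nat -> E) B :
  embeds Y -> (forall n, `|w n| <= B) -> schauder_basis e -> generates_sm w e ->
  lp_equiv p e.
Proof.
move=> [T [c [C Temb]]] wB eb gen.
have [c0 C0 Tlin Tn] := Temb.
pose S J (a : nat -> R) := `|\sum_(i < J) a i *: e i|.
have xB n : bounded_by (T (w n)) (C * B).
  have [TX /andP[_ Tw]] := Tn (w n) => m K k mKk.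
  apply: le_trans (colnorm_xnorm TX mKk) _; apply: le_trans Tw _.
  by rewrite ler_wpM2l// ltW.
have [sigma [z [L [v [D dec]]]]] := block_decomposition_exists q1 qp r_le xB.
have [[zX _ D0] [L_mono L_ge] v_supp vP _] := dec.
have sig_inc := decomp_inc dec.
(* Far along the subsequence the norms of combinations come arbitrarily close to those in the
   spreading model, so estimates that hold for all large [l] pass to [S]. *)
have approx J (a : nat -> R) (eps : R) : 0 < eps -> exists l0, forall l, (l0 <= l)%N ->
    `| `|\sum_(i < J) a i *: w (sigma (l + i)%N)| - S J a| <= eps.
  move=> eps0; have [l0 l0P] := generates_sm_approx gen J a eps0; exists l0 => l l0l.
  apply: (l0P (fun i => sigma (l + i)%N)) => [i j ij|]; first by apply: sig_inc; rewrite ltn_add2l.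
  by rewrite addn0; apply: leq_trans l0l (decomp_ge dec l).
have TE J (a : nat -> R) l : T (\sum_(i < J) a i *: w (sigma (l + i)%N)) =
    comb J a (fun i => T (w (sigma (l + i)%N))) by exact: embedding_sum Temb.
have cX J (a : nat -> R) l : inX (comb J a (fun i => T (w (sigma (l + i)%N)))).
  by rewrite -TE; have [] := Tn (\sum_(i < J) a i *: w (sigma (l + i)%N)).
pose D4 := D + 4; have D40 : 0 < D4 by rewrite ltr_wpDl.
have S_upper J (a : nat -> R) : c * S J a <= `|\sum_(i < J) a i| * xnorm z + D4 * pn p J a.
  apply/ler_addgt0Pr => eps eps0.
  have [l /(_ l (leqnn l))] := approx J a _ (divr_gt0 eps0 c0).
  have := decomp_upper dec J l a; rewrite -TE.
  have [_ /andP[+ _]] := Tn (\sum_(i < J) a i *: w (sigma (l + i)%N)).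
  move=> h1 h2; rewrite ler_distlC => /andP[_ h3].
  have : S J a <= `|\sum_(i < J) a i *: w (sigma (l + i)%N)| + eps / c by exact: h3.
  rewrite -(ler_pM2l c0) mulrDr [c * (eps / c)]mulrC divfK ?gt_eqF//.
  by move/le_trans; apply; rewrite lerD2r (le_trans h1 h2).
have S_mean J (a : nat -> R) : `|\sum_(i < J) a i| * xnorm z <= C * S J a + D4 * pn p J a.
  apply/ler_addgt0Pr => eps eps0.
  have [l /(_ l (leqnn l))] := approx J a _ (divr_gt0 eps0 C0).
  have := decomp_mean dec (cX J a l); rewrite -TE.
  have [_ /andP[_ +]] := Tn (\sum_(i < J) a i *: w (sigma (l + i)%N)).
  move=> h1 h2; rewrite ler_distl => /andP[_ h3].
  apply: le_trans h2 _; rewrite addrAC lerD2r; apply: le_trans h1 _.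
  by move: h3; rewrite -(ler_pM2l C0) mulrDr [C * (eps / C)]mulrC divfK ?gt_eqF.
pose th := `|e 0%N - e 1%N|.
have th0 : 0 < th.
  rewrite normr_gt0 subr_eq0; apply/eqP => /(schauder_basis_inj eb) //.
(* In a difference of two terms [z] cancels, and its norm stays above [th / 2] as [e 0 <> e 1]. In X
   this is at least c * th / 2 = 4 d, of which the errors take at most 2 d, so two late blocks
   cannot both be shorter than [d]. *)
have [d [l2 [d0 dP]]] : exists d l2, 0 < d /\ forall j, (l2 <= j)%N -> d <= xnorm (v j).
  pose d := c * th / 8.
  have d0 : 0 < d by rewrite !mulr_gt0// invr_gt0.
  have [l1 pairs] : exists l1, forall i j, (l1 <= i)%N -> (i < j)%N ->
      2 * d <= xnorm (v i) + xnorm (v j).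
    pose a k : R := if k == 0%N then 1 else -1.
    have [l0 l0P] := generates_sm_approx gen 2 a (divr_gt0 th0 (ltr0n _ 2)).
    have [m mP] : exists m, 2^-1 ^+ m * 4 <= 2 * d.
      have [m h] : exists m, (2 * d)^-1 * 4 <= m%:R.
        by exists (Num.bound ((2 * d)^-1 * 4)); apply/ltW/archi_boundP; rewrite mulr_ge0// invr_ge0 mulr_ge0// ltW.
      exists m; rewrite exprVn ler_pdivrMl ?exprn_gt0//.
      rewrite -ler_pdivrMr ?mulr_gt0// mulrC (le_trans h)//.
      by rewrite -natrX ler_nat ltnW// ltn_expl.
    exists (maxn l0 m) => i j; rewrite geq_max => /andP[l0i mi] ij.
    (* Only the first two terms, [sigma i] and [sigma j], enter; the rest completes an increasing
       sequence. *)
    pose n k := if k == 0%N then sigma i else sigma (j + k.-1)%N.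
    have n_inc k k' : (k < k')%N -> (n k < n k')%N.
      rewrite /n; case: k' => // k' kk'; case: k kk' => [_|k kk'] /=.
        by apply: sig_inc; apply: leq_trans ij (leq_addr _ _).
      by apply: sig_inc; rewrite ltn_add2l.
    have := l0P n n_inc (leq_trans l0i (decomp_ge dec i)).
    rewrite (sum_ord2 (fun i => a i *: w (n i))) (sum_ord2 (fun i => a i *: e i)).
    rewrite /a /n /= !scale1r !scaleN1r addn0 -/th.
    rewrite ler_distlC => /andP[_ h].
    have {h} h : th / 2 <= `|w (sigma i) - w (sigma j)|.
      by lra.
    have [TX /andP[+ _]] := Tn (w (sigma i) - w (sigma j)).
    have hh : c * (th / 2) <= c * `|w (sigma i) - w (sigma j)| by rewrite ler_pM2l.
    move=> /(le_trans hh).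
    have -> : T (w (sigma i) - w (sigma j)) = fun s =>
       (v i s + (T (w (sigma i)) s - z s - v i s)) +
       - 1 * (v j s + (T (w (sigma j)) s - z s - v j s)).
      by apply/funext => s; rewrite addrC -scaleN1r Tlin; ring.
    move=> /le_trans hT.
    have [viX _ ei] := vP i; have [vjX _ ej] := vP j.
    have {hT} := hT _ (bounded_xnorm (boundedD q1 qp
      (boundedD q1 qp (xnorm_bounded viX) ei) (xnorm_bounded (inXZ q1 qp (-1)
        (inXD q1 qp vjX (bounded_inX ej)))))).
    rewrite xnormZ; [|by []|by []|exact: inXD vjX (bounded_inX ej)].
    rewrite normrN1 mul1r.
    have := bounded_xnorm (boundedD q1 qp (xnorm_bounded vjX) ej).
    have im : (2^-1 : R) ^+ i <= 2^-1 ^+ m.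
      by apply: ler_wiXn2l mi; rewrite ?invr_ge0// invf_le1// ler1n.
    have jm : (2^-1 : R) ^+ j <= 2^-1 ^+ m.
      by apply: ler_wiXn2l (leq_trans mi (ltnW ij)); rewrite ?invr_ge0// invf_le1// ler1n.
    have -> : c * (th / 2) = 4 * d by rewrite /d; field.
    lra.
  (* At most one block from [l1] on is short; if there is one, the count starts after it. *)
  have [[j0 [l1j0 vj0]]|none] :=
      pselect (exists j, (l1 <= j)%N /\ xnorm (v j) < d).
    exists d, j0.+1; split=> // j j0j.
    by have := pairs _ _ l1j0 j0j; lra.
  exists d, l1; split=> // j l1j; rewrite leNgt; apply/negP => h.
  by apply: none; exists j.
have S_lower J (a : nat -> R) : d * pn p J a <= C * S J a.
  apply/ler_addgt0Pr => eps eps0.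
  (* The errors in the final estimate add up to A * eta = eps. *)
  pose A := `|\sum_(i < J) a i| + 4 * pn p J a + C.
  have A0 : 0 < A by rewrite ltr_wpDl// addr_ge0// mulr_ge0// pn_ge0.
  pose eta := eps / A; have eta0 : 0 < eta by rewrite divr_gt0.
  have [l0 l0P] := approx J a _ eta0.
  have [M MP] := xnorm_tail q1 qp zX eta0.
  have [m mP] : exists m, (2^-1 : R) ^+ m <= eta.
    have [m h] : exists m, eta^-1 <= m%:R.
      by exists (Num.bound eta^-1); apply/ltW/archi_boundP; rewrite invr_ge0 ltW.
    exists m; rewrite exprVn -[leRHS]invrK lef_pV2 ?posrE ?exprn_gt0 ?invr_gt0//.
    by rewrite (le_trans h)// -natrX ler_nat ltnW// ltn_expl.
  pose l := maxn (maxn l0 l2) (maxn M m).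
  have [l0l l2l Ml ml] : [/\ (l0 <= l)%N, (l2 <= l)%N, (M <= l)%N & (m <= l)%N].
    by rewrite /l; split; rewrite !leq_max leqnn ?orbT.
  have h1 := l0P l l0l.
  have h2 := @decomp_block_lower _ _ _ _ _ _ dec J l a d (ltW d0) (cX J a l)
    (fun j lj => dP j (leq_trans l2l lj)).
  have h3 : xnorm (restr (fun s => (L l <= s)%N) z) <= eta.
    by apply: MP => s; apply: leq_trans; exact: leq_trans Ml (L_ge l).
  have h4 : (2^-1 : R) ^+ l <= eta.
    by apply: le_trans mP; apply: ler_wiXn2l; rewrite ?invr_ge0 ?invf_le1 ?ler1n.
  apply: le_trans h2 _; rewrite -TE.
  have [_ /andP[_ h5]] := Tn (\sum_(i < J) a i *: w (sigma (l + i)%N)).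
  have -> : eps = C * eta + (`|\sum_(i < J) a i| * eta + 4 * eta * pn p J a).
    transitivity (A * eta); first by rewrite /eta mulrC divfK ?gt_eqF.
    by rewrite /A; ring.
  rewrite [leRHS]addrA; apply: lerD.
    apply: le_trans h5 _; rewrite -mulrDr ler_pM2l//.
    by move: h1; rewrite ler_distl => /andP[].
  apply: lerD; first exact: ler_wpM2l.
  by apply: ler_wpM2r; rewrite ?pn_ge0// ler_wpM2l.
(* With z = 0 the term with the sum of the coefficients disappears from [S_upper], which together
   with [S_lower] is the equivalence. *)
suff z0 : xnorm z = 0.
  exists (d / C), (D4 / c); split; rewrite ?divr_gt0// => n a; apply/andP; split.
    by rewrite mulrAC ler_pdivrMr// [leRHS]mulrC; exact: S_lower.
  rewrite mulrAC ler_pdivlMr// mulrC.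
  by have := S_upper n a; rewrite z0 mulr0 add0r.
(* If z <> 0 then the averages of e converge to a nonzero vector all of whose
   coordinates in the basis e vanish. *)
pose avg K := \sum_(i < K) (K%:R^-1 : R) *: e i.
pose ca K i : R := if (i < K)%N then K%:R^-1 else 0.
have avgE K n : (K <= n)%N -> avg K = \sum_(i < n) ca K i *: e i.
  move=> Kn; rewrite /avg (big_ord_widen _ (fun i => K%:R^-1 *: e i) Kn) big_mkcond/=.
  by apply: eq_bigr => i _; rewrite /ca; case: ifP => _; rewrite ?scale0r.
have ca_sum K n : (0 < K)%N -> (K <= n)%N -> \sum_(i < n) ca K i = 1.
  move=> K0 Kn; rewrite /ca -big_mkcond/= -(big_ord_widen _ (fun=> K%:R^-1) Kn).
  exact: sum_average.
have ca_pn K n : pn p n (ca K) <= pn p K (fun=> K%:R^-1).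
  apply: le_trans (_ : pn p n (restr (fun i => (i < K)%N) (fun=> K%:R^-1)) <= _).
    by apply: ler_pn => // i _; rewrite /ca /restr; case: ifP => _; rewrite ?mulr0n.
  exact: pn_restr_le.
have avg_cauchy : cauchy (avg @ \oo).
  apply/cauchy_ballP => eps eps0.
  have eps1 : 0 < c * eps / (D4 * 4) by rewrite divr_gt0 ?mulr_gt0.
  have [N NP] := pn_average_small p1 eps1.
  (* The coefficients of the difference of two averages sum to 0, so [S_upper] leaves only the l^p
     norms of the averages, which tend to 0. *)
  have small K K' : (N <= K)%N -> (N <= K')%N -> `|avg K - avg K'| < eps.
    move=> NK NK'; have [K0 hK] := NP K NK; have [K0' hK'] := NP K' NK'.
    pose n := maxn K K'.
    rewrite (avgE K n) ?leq_maxl// (avgE K' n) ?leq_maxr// -sumrB.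
    have -> : \sum_(i < n) (ca K i *: e i - ca K' i *: e i) =
        \sum_(i < n) (ca K i + - 1 * ca K' i) *: e i.
      by apply: eq_bigr => i _; rewrite mulN1r scalerDl scaleNr.
    have := S_upper n (fun i => ca K i + - 1 * ca K' i).
    rewrite big_split/= -mulr_sumr !ca_sum ?leq_maxl ?leq_maxr// mulr1 subrr normr0 mul0r add0r.
    rewrite /S => h.
    have h' : pn p n (fun i => ca K i + - 1 * ca K' i) <= c * eps / (D4 * 4) + c * eps / (D4 * 4).
      apply: le_trans (ler_pnD _ _ _ p1) _; rewrite pnZ// normrN1 mul1r.
      by apply: lerD; [exact: le_trans (ca_pn _ _) hK|exact: le_trans (ca_pn _ _) hK'].
    have : c * `|\sum_(i < n) (ca K i + - 1 * ca K' i) *: e i| <= c * (eps / 2).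
      apply: le_trans h _; apply: le_trans (ler_wpM2l (ltW D40) h') _.
      by rewrite le_eqVlt; apply/orP; left; apply/eqP; field; rewrite gt_eqF.
    rewrite ler_pM2l// => /le_lt_trans; apply; lra.
  near=> u; near: u.
  exists ([set avg n | n in [set n | (N <= n)%N]], [set avg n | n in [set n | (N <= n)%N]]).
    by split; exists N => //= n Nn; exists n.
  by move=> [_ _] /= [[K NK <-] [K' NK' <-]]; rewrite -ball_normE /=; exact: small.
have avg_cvg : cvg (avg @ \oo) by exact: cauchy_cvg.
have [u avg_u] : exists u : E, avg @ \oo --> u by exists (lim (avg @ \oo)).
have [b [bu _]] := eb u.
(* [S_lower] bounds each coordinate by the norm, so the coordinates of the averages converge to
   those of [u]; they also tend to 0. *)
have b0 i : b i = 0.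
  apply/eqP; rewrite -normr_le0; apply/ler_addgt0Pr => eps eps0; rewrite add0r.
  pose h : R := Num.min (eps / 2) (d * eps / (C * 4)).
  have h0 : 0 < h by rewrite lt_min !divr_gt0 ?mulr_gt0.
  have [N1 _ N1P] : \forall K \near \oo, `|u - avg K| <= h.
    by move/cvgrPdist_le: avg_u; exact.
  have [N2 _ N2P] : \forall n \near \oo, `|u - \sum_(i < n) b i *: e i| <= h.
    by move/cvgrPdist_le: bu; exact.
  have [N3 N3P] := pn_average_small p1 h0.
  pose K := maxn N1 N3; pose n := maxn (maxn N2 K) i.+1.
  have [K0 Kh] := N3P K (leq_maxr _ _).
  have in' : (i < n)%N by rewrite leq_max ltnSn orbT.
  have Kn : (K <= n)%N by apply: leq_trans (leq_maxl _ _); exact: leq_maxr.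
  have h1 := N1P K (leq_maxl _ _); have N2n : (N2 <= n)%N by apply: leq_trans (leq_maxl _ _); exact: leq_maxl.
  have h2 := N2P n N2n.
  have h3 : `|\sum_(i < n) (b i + - 1 * ca K i) *: e i| <= h + h.
    have -> : \sum_(i < n) (b i + - 1 * ca K i) *: e i = (u - avg K) - (u - \sum_(i < n) b i *: e i).
      rewrite (avgE K n Kn) opprB addrC addrA subrK -sumrB.
      by apply: eq_bigr => j _; rewrite mulN1r scalerDl scaleNr.
    by apply: le_trans (ler_normB _ _) _; exact: lerD.
  have h4 : d * `|b i + - 1 * ca K i| <= C * (h + h).
    apply: le_trans (_ : d * pn p n (fun i => b i + - 1 * ca K i) <= _).
      by rewrite ler_pM2l//; exact: (@ler_pn_coord _ p n (fun i => b i + - 1 * ca K i) i).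
    by apply: le_trans (S_lower _ _) _; rewrite ler_pM2l.
  have h5 : `|ca K i| <= eps / 2.
    apply: le_trans (ler_pn_coord _ p0 in') _; apply: le_trans (ca_pn K n) _.
    by apply: le_trans Kh _; rewrite ge_min lexx.
  have h6 : `|b i + - 1 * ca K i| <= eps / 2.
    rewrite -(ler_pM2l d0); apply: le_trans h4 _.
    have : h <= d * eps / (C * 4) by rewrite ge_min lexx orbT.
    rewrite ler_pdivlMr ?mulr_gt0// => ?; lra.
  have -> : b i = (b i + - 1 * ca K i) + ca K i by ring.
  by apply: le_trans (ler_normD _ _) _; rewrite [eps]splitr lerD.
have u0 : u = 0.
  apply/eqP; rewrite -normr_le0; apply/ler_addgt0Pr => eps eps0; rewrite add0r.
  move/cvgrPdist_le: bu => /(_ eps eps0) [N _ /(_ N (leqnn N))] /=.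
  by rewrite big1 ?subr0// => i _; rewrite b0 scale0r.
(* The averages tend to u = 0 while their coefficients sum to 1, so [S_mean] makes the norm of [z]
   arbitrarily small. *)
apply/eqP; rewrite eq_le xnorm_ge0// andbT; apply/ler_addgt0Pr => eps eps0.
have h1 : 0 < eps / 2 / C by rewrite !divr_gt0.
have h2 : 0 < eps / 2 / D4 by rewrite !divr_gt0.
have [N1 _ N1P] : \forall K \near \oo, `|u - avg K| <= eps / 2 / C.
  by move/cvgrPdist_le: avg_u; exact.
have [N2 N2P] := pn_average_small p1 h2.
pose K := maxn N1 N2; have [K0 Kh] := N2P K (leq_maxr _ _).
have := N1P K (leq_maxl _ _); rewrite /= u0 sub0r normrN ler_pdivlMr// => h3.
have := S_mean K (fun=> K%:R^-1).
rewrite sum_average// normr1 mul1r => /le_trans; apply.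
rewrite add0r [eps]splitr; apply: lerD; first by rewrite mulrC.
by rewrite mulrC -ler_pdivlMr.
Unshelve. all: by end_near.
Qed.

End Embedded.

(** * Iterated spreading models *)

Section EllNorm.
Variable R : realType.

Lemma ell_norm_sum (p : R) n (a : nat -> R) : 0 < p ->
  ell_norm p (\sum_(i < n) a i *: ell_basis R i) = pn p n a.
Proof.
move=> p0; rewrite /ell_norm Lnorm_counting//.
set f := \sum_(i < n) _.
have fE k : f k = if (k < n)%N then a k else 0.
  rewrite /f fct_sumE; case: ltnP => kn.
    rewrite (bigD1 (Ordinal kn))//= big1 ?addr0.
      by rewrite -[LHS]/(a k * (k == k)%:R) eqxx mulr1.
    move=> i ik; rewrite -[LHS]/(a i * (k == i)%:R).
    have -> : (k == i :> nat) = false by apply: contraNF ik => /eqP ki; apply/eqP/val_inj.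
    by rewrite mulr0.
  rewrite big1// => i _; rewrite -[LHS]/(a i * (k == i)%:R).
  by rewrite gtn_eqF ?mulr0// (leq_trans (ltn_ord i)).
rewrite (nneseries_split 0 n); last by move=> k; rewrite poweR_ge0.
rewrite add0n ereal_series_cond eseries0 ?adde0; last first.
  by move=> k _ /andP[nk _]; rewrite /= fE ltnNge nk /= normr0 powR0// gt_eqF.
rewrite big_mkord (eq_bigr (fun i : 'I_n => (`|a i| `^ p)%:E)).
  by rewrite sumEFin poweR_EFin /= pnE.
by move=> i _; rewrite /= fE ltn_ord.
Qed.

Lemma lp_equiv_ell (p : R) (E : normedModType R) (e : nat -> E) : 0 < p ->
  lp_equiv p e -> equivalent_to_ell (@Num.norm R E) e p.
Proof.
move=> p0 [c [C [c0 C0 h]]]; exists c, C; split=> // n a.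
by rewrite ell_norm_sum.
Qed.

End EllNorm.

(* The 2-adic valuation of s + 1, so that 2^m (2n+1) - 1 is in row m. *)
Definition rowof (s : nat) : nat := logn 2 s.+1.

Lemma row_le s : (rowof s <= s)%N.
Proof. by rewrite -ltnS; apply: ltn_logl. Qed.

Lemma row_double j : rowof j.*2 = 0%N.
Proof.
rewrite /rowof lognE /=; case: ifP => //; rewrite dvdn2 /= odd_double//.
Qed.

Lemma row_eq0 s : rowof s = 0%N -> s = s./2.*2.
Proof.
move=> s0; rewrite -[LHS]odd_double_half; case: (boolP (odd s)) => // so.
by move: s0; rewrite /rowof lognE /= dvdn2 /= so.
Qed.

Section IteratedSpreadingModels.
Variables (R : realType) (p q : R).
Hypothesis (q1 : 1 < q) (qp : q < p).
Notation inX := (inX p q rowof).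
Notation xnorm := (xnorm p q rowof).

Let p1 : 1 < p. Proof. exact: lt_trans qp. Qed.
Let p0 : 0 < p. Proof. exact: lt_trans p1. Qed.
Let q0 : 0 < q. Proof. exact: lt_trans q1. Qed.

(** The sequence [a] placed on the even numbers, which are exactly row 0. *)
Definition row0 (a : nat -> R) : nat -> R :=
  fun s => if rowof s == 0%N then a s./2 else 0.

Lemma sum_double (V : zmodType) (F : nat -> V) n :
  \sum_(s < n.*2) F s = \sum_(j < n) (F j.*2 + F j.*2.+1).
Proof.
elim: n => [|n IH]; first by rewrite !big_ord0.
by rewrite doubleS !big_ord_recr/= IH addrA.
Qed.

Lemma row0_double a j : row0 a j.*2 = a j.
Proof. by rewrite /row0 row_double doubleK. Qed.

Lemma row0_odd a j : row0 a j.*2.+1 = 0.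
Proof.
rewrite /row0; case: eqP => // /row_eq0 /(congr1 odd).
by rewrite oddS !odd_double.
Qed.

Lemma pn_row0 n a : pn p n.*2 (row0 a) = pn p n a.
Proof.
rewrite !pnE (sum_double (fun s => `|row0 a s| `^ p)); congr (_ `^ _).
apply: eq_bigr => j _; rewrite row0_double row0_odd normr0 powR0 ?addr0//.
by rewrite gt_eqF.
Qed.

(** A single nonzero row turns the l^q sum of the row norms into one l^p norm. *)
Lemma row0_bounded a b : (forall n, pn p n a <= b) -> bounded_by p q rowof (row0 a) b.
Proof.
move=> ab n K c _; apply: le_trans (colnorm_rows rowof q1 qp n K c _) _.
apply: le_trans (ab n); rewrite -pn_row0.
apply: le_trans (_ : pn p n (row0 a) <= _); last first.
  by apply: ler_pn_widen => //; rewrite -addnn leq_addr.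
have rn i : rownorm p rowof n (row0 a) i = pn p n (row0 a) *+ (i == 0%N).
  case: eqP => [->|/eqP i0]; [rewrite mulr1n|rewrite mulr0n].
    by apply: eq_pn => s _; rewrite /row0; case: eqP => _; rewrite ?mulr1n ?mul0rn.
  rewrite -(@pn0 _ p n)//; apply: eq_pn => s _; congr `|_|.
  rewrite /row0; have [->|_] := eqVneq (rowof s) 0%N; last by rewrite mul0rn.
  by rewrite eq_sym (negPf i0) mulr0n.
rewrite pn_le_pow ?pn_ge0//; case: n rn => [|n] rn; first by rewrite big_ord0 powR_ge0.
rewrite big_ord_recl rn mulr1n big1 ?addr0 ?ger0_norm ?pn_ge0// => i _.
by rewrite rn mulr0n normr0 powR0// gt_eqF.
Qed.

Lemma row0_lower a n : inX (row0 a) -> pn p n a <= xnorm (row0 a).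
Proof.
move=> aX; apply: le_trans (_ : rownorm p rowof n.*2 (row0 a) 0 <= _); last first.
  exact: (rownorm_le_xnorm q1 qp row_le _ _ aX).
rewrite -pn_row0; apply: ler_pn => // s _; rewrite /row0.
by case: eqP => _; rewrite ?mulr1n ?mul0rn.
Qed.

Lemma converges_to_linear (E : normedModType R) (e : nat -> E) (a b : nat -> R)
    (k : R) u v : converges_to e a u -> converges_to e b v ->
  converges_to e (fun i => k * a i + b i) (k *: u + v).
Proof.
move=> au bv; rewrite /converges_to.
rewrite (_ : (fun n => _) = fun n : nat => k *: (\sum_(i < n) a i *: e i) + \sum_(i < n) b i *: e i).
  by apply: cvgD => //; apply: cvgZr.
apply/funext => n; rewrite scaler_sumr -big_split/=; apply: eq_bigr => i _.
by rewrite scalerDl scalerA.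
Qed.

Lemma converges_to_norm (E : normedModType R) (e : nat -> E) a u eps :
  converges_to e a u -> 0 < eps -> exists N, forall n, (N <= n)%N ->
  `|u| <= `|\sum_(i < n) a i *: e i| + eps /\ `|\sum_(i < n) a i *: e i| <= `|u| + eps.
Proof.
move=> /cvgrPdist_le h /h [N _ NP]; exists N => n Nn.
have := NP n Nn; rewrite /= => {}h.
have := le_trans (ler_dist_dist _ _) h; rewrite ler_distl.
by rewrite lerBlDr => /andP[h1 h2]; split=> //; rewrite -lerBlDr.
Qed.

(** The coordinates of a vector are placed in row 0, where the norm of X is the l^p norm. Uniqueness
    of the expansion makes the map linear. *)
Lemma lp_basis_embeds (E : normedModType R) (e : nat -> E) :
  schauder_basis e -> lp_equiv p e -> embeds p q rowof E.
Proof.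
move=> eb [c [C [c0 C0 ec]]].
have /choice[a aP] : forall v, exists a, converges_to e a v.
  by move=> v; have [a []] := eb v; exists a.
have aU v b : converges_to e b v -> a v = b.
  move=> bv; have [d [_ dU]] := eb v.
  by rewrite -(dU _ bv) -(dU _ (aP v)).
have a_upper v n : pn p n (a v) <= c^-1 * `|v|.
  rewrite -ler_pdivrMl ?invr_gt0// invrK.
  apply/ler_addgt0Pr => eps eps0; have [N NP] := converges_to_norm (aP v) eps0.
  have [_ +] := NP (maxn N n) (leq_maxl _ _); apply: le_trans.
  have /andP[+ _] := ec (maxn N n) (a v); apply: le_trans.
  by rewrite ler_pM2l//; apply: ler_pn_widen => //; exact: leq_maxr.
have aX v : inX (row0 (a v)) by exists (c^-1 * `|v|); exact: row0_bounded.
exists (fun v => row0 (a v)), C^-1, c^-1; split; rewrite ?invr_gt0//.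
  move=> k u v s; rewrite (aU _ _ (@converges_to_linear E e (a u) (a v) k u v (aP u) (aP v))).
  by rewrite /row0; case: eqP; rewrite ?mulr0 ?addr0.
move=> v; split=> //; apply/andP; split; last by apply: bounded_xnorm; exact: row0_bounded.
rewrite ler_pdivrMl//; apply/ler_addgt0Pr => eps eps0.
have [N NP] := converges_to_norm (aP v) eps0.
have [/le_trans + _] := NP N (leqnn N); apply; rewrite lerD2r.
have /andP[_ +] := ec N (a v); move/le_trans; apply.
by rewrite ler_pM2l//; exact: row0_lower.
Qed.

(** The class of spaces that embed in X is stable under one step, because the new basis is
    equivalent to that of l^p. *)
Lemma sm_step_lp (X E : completeNormedModType R) : embeds p q rowof X ->
  sm_step X E -> embeds p q rowof E.
Proof.
move=> Xemb [x [e [_ [c [C [_ xC]]] eb [m _ gen]]]].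
apply: (lp_basis_embeds eb); apply: (spreading_model_lp q1 qp row_le Xemb _ eb gen).
by move=> n; have /andP[_] := xC (m n); exact.
Qed.

Lemma iterated_sm_step_lp l (X E : completeNormedModType R) :
  iterated_sm_step l X E -> embeds p q rowof X -> embeds p q rowof E.
Proof.
elim=> [Y F st|k Y F1 F st _ IH] Yemb; first exact: sm_step_lp st.
by apply: IH; exact: sm_step_lp st.
Qed.

(** The sequence [e] of an iterated spreading model need not be the basis produced by the last step;
    being spreading, it is a spreading model of itself, so [spreading_model_lp] applies to it inside
    E. *)
Lemma spreading_generates_itself (E : normedModType R) (e : nat -> E) :
  spreading_seq e -> generates_sm e e.
Proof.
move=> es; exists (fun n => n.+1%:R^-1).
  split=> [n|]; first by rewrite invr_gt0 ltr0n.
  exact: cvg_harmonic.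
move=> k n a n_inc _ _; rewrite -es// subrr normr0.
by rewrite invr_gt0 ltr0n.
Qed.

Lemma iterated_spreading_model_lp l (X E : completeNormedModType R) (e : nat -> E) :
  embeds p q rowof X -> iterated_spreading_model l X e ->
  equivalent_to_ell (@Num.norm R E) e p.
Proof.
move=> Xemb [eb es espan st]; apply: lp_equiv_ell => //.
have Eemb := iterated_sm_step_lp st Xemb.
have eb' : schauder_basis e by move=> v; apply: eb; rewrite espan.
apply: (spreading_model_lp q1 qp row_le Eemb (B := `|e 0%N|) _ eb'); last first.
  exact: spreading_generates_itself.
move=> n.
have := es 1%N (fun=> n) (fun=> 1) _; rewrite !big_ord1 !scale1r => -> //.
by move=> i j; rewrite !ord1 ltnn.
Qed.

End IteratedSpreadingModels.

(** * The Banach space X *)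

Section Space.
Variables (R : realType) (p q : R).
Hypothesis (q1 : 1 < q) (qp : q < p).

(** The proofs of [1 < q] and [q < p] are parameters of the predicate, hence of the type [xspace]:
    the subspace structure and the norm axioms rest on them. *)
Definition xpredicate (_ : 1 < q) (_ : q < p) : {pred (nat -> R^o)} :=
  fun x => `[< inX p q rowof x >].

Local Notation P := (xpredicate q1 qp).

Lemma xpredicateP (x : nat -> R) : reflect (inX p q rowof x) ((x : nat -> R^o) \in P).
Proof. exact: asboolP. Qed.

Lemma xpredicate_submod : submod_closed P.
Proof.
split; first by apply/xpredicateP; exact: inX0 q1 qp row_le.
move=> a u v /xpredicateP uX /xpredicateP vX; apply/xpredicateP.
suff : inX p q rowof (fun s => a * u s + v s) by [].
by apply: inXD => //; exact: inXZ.
Qed.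

HB.instance Definition _ := GRing.isSubmodClosed.Build R (nat -> R^o) P xpredicate_submod.

Record xspace := XSpace { xval :> nat -> R^o; xvalP : xval \in P }.

HB.instance Definition _ := [isSub for xval].
HB.instance Definition _ := [Choice of xspace by <:].
HB.instance Definition _ := [SubChoice_isSubLmodule of xspace by <:].


Lemma xval_inX (x : xspace) : inX p q rowof x. Proof. exact/xpredicateP/xvalP. Qed.

Definition xspace_norm (x : xspace) : R := xnorm p q rowof x.

Lemma xspace_normD x y : xspace_norm (x + y) <= xspace_norm x + xspace_norm y.
Proof. exact: (xnormD q1 qp (xval_inX x) (xval_inX y)). Qed.

Lemma xspace_normZ (a : R) x : xspace_norm (a *: x) = `|a| * xspace_norm x.
Proof. exact: (xnormZ q1 qp a (xval_inX x)). Qed.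

Lemma xspace_norm_eq0 x : xspace_norm x = 0 -> x = 0.
Proof.
move=> /(xnorm_eq0 q1 qp row_le (xval_inX x)) x0; apply: val_inj.
by apply/funext => s; exact: x0.
Qed.

HB.instance Definition _ := Lmodule_isNormed.Build R xspace
  xspace_normD xspace_normZ xspace_norm_eq0.

Lemma xspace_normE (x : xspace) : `|x| = xnorm p q rowof x. Proof. by []. Qed.

Definition mkX (x : nat -> R) (xX : inX p q rowof x) : xspace := XSpace (introT (xpredicateP x) xX).

Lemma xspace_coord (x : xspace) s : `|x s| <= `|x|.
Proof. exact: (xnorm_coord q1 qp row_le s (xval_inX x)). Qed.

Lemma xspace_complete (F : set_system xspace) : ProperFilter F -> cauchy F -> cvg F.
Proof.
move=> FF /cauchy_ballP Fc.
have small eps : 0 < eps -> exists2 A, F A & forall u v, A u -> A v -> `|u - v| <= eps.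
  move=> eps0; have [[A B] [/= FA FB] AB] := Fc eps eps0.
  exists (A `&` B); first exact: filterI.
  by move=> u v [Au _] [_ Bv]; have := AB (u, v) (conj Au Bv); rewrite -ball_normE /= => /ltW.
have /choice[z zP] : forall s, exists l : R, forall eps, 0 < eps ->
    F [set u : xspace | `|u s - l| <= eps].
  move=> s; have Gc : cauchy ((fun u : xspace => u s : R^o) @ F).
    apply/cauchy_ballP => eps eps0.
    have [A FA Asmall] := small (eps / 2) (divr_gt0 eps0 (ltr0n _ 2)).
    exists ((fun u : xspace => u s : R^o) @` A, (fun u : xspace => u s : R^o) @` A).
      by split; apply: (@filterS _ F _ A) => // u Au; apply/imageP.
    move=> [_ _] /= [[u Au <-] [v Av <-]]; rewrite -ball_normE /=.
    apply: le_lt_trans (le_trans (xspace_coord (u - v) s) (Asmall u v Au Av)) _.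
    by rewrite ltr_pdivrMr// ltr_pMr// ltr1n.
  have GP : ProperFilter ((fun u : xspace => u s : R^o) @ F) by apply: fmap_proper_filter.
  have /cvgrPdist_le h := R_complete GP Gc.
  exists (lim ((fun u : xspace => u s : R^o) @ F)) => eps eps0.
  by have := h eps eps0; apply: filterS => u /=; rewrite distrC.
have zsum n eps : 0 < eps -> F [set u : xspace | \sum_(s < n) `|u s - z s| <= eps].
  elim: n eps => [|n IH] eps eps0.
    by apply: filterS filterT => u _ /=; rewrite big_ord0 ltW.
  have e2 : 0 < eps / 2 by rewrite divr_gt0.
  apply: filterS (filterI (IH _ e2) (zP n _ e2)) => u [/= a b].
  by rewrite big_ord_recr/= [eps]splitr lerD.
(* [colnorm n] sees only the first [n] coordinates, on which some [v] in [A] is within [d] of [z];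
   so the bound for [v - u] passes to [z - u]. *)
have near_z A eps : F A -> 0 < eps -> (forall u v, A u -> A v -> `|u - v| <= eps) ->
    forall u, A u -> bounded_by p q rowof (fun s => z s - u s) eps.
  move=> FA eps0 Asmall u Au n K c nKc; apply/ler_addgt0Pr => d d0.
  have [v [Av /= vz]] := filter_ex (filterI FA (zsum n d d0)).
  rewrite (_ : (fun s => z s - u s) = fun s => (v - u) s + (z s - v s)); last first.
    by apply/funext => s; rewrite -[(v - u) s]/(v s - u s); ring.
  apply: le_trans (colnormD _ q1 qp _ _ _ _ _) _; apply: lerD.
    by apply: le_trans (Asmall v u Av Au); exact: colnorm_xnorm (xval_inX _) nKc.
  apply: le_trans (colnorm_l1 q1 qp row_le _ _ _ _) _; apply: le_trans vz.
  by apply: ler_sum => s _; rewrite distrC.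
have zX : inX p q rowof z.
  have [A FA Asmall] := small 1 ltr01; have [u Au] := filter_ex FA.
  have uz := near_z A 1 FA ltr01 Asmall u Au.
  rewrite (_ : z = fun s => (z s - u s) + u s); last by apply/funext => s; rewrite subrK.
  by apply: inXD => //; [exists 1|exact: xval_inX].
apply: (cvgP (mkX zX)); apply/cvgrPdist_le => eps eps0.
have [A FA Asmall] := small eps eps0.
apply: (@filterS _ F _ A) => // u Au.
by apply: (@bounded_xnorm _ p q rowof); exact: (near_z A).
Qed.

HB.instance Definition _ := Uniform_isComplete.Build xspace xspace_complete.


End Space.

(** * Unconditional basis and reflexivity *)

Section DualSpace.
Variables (R : realType) (Y : normedModType R).
Implicit Types f : Y -> R^o.

Lemma linear_form0 f : linear f -> f 0 = 0.
Proof.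
move=> flin; have := flin 1 0 0; rewrite scaler0 addr0 scale1r => /eqP.
by rewrite -subr_eq subrr => /eqP <-.
Qed.

Lemma linear_formZ f a x : linear f -> f (a *: x) = a * f x.
Proof. by move=> flin; have := flin a x 0; rewrite linear_form0// !addr0. Qed.

Lemma linear_formB f x y : linear f -> f (x - y) = f x - f y.
Proof.
by move=> flin; rewrite [in LHS]addrC -scaleN1r flin scaleN1r addrC.
Qed.

Lemma linear_form_sum f n (a : nat -> R) (w : nat -> Y) : linear f ->
  f (\sum_(i < n) a i *: w i) = \sum_(i < n) a i * f (w i).
Proof.
move=> flin; elim: n => [|n IH]; first by rewrite !big_ord0 linear_form0.
by rewrite !big_ord_recr/= addrC flin IH addrC.
Qed.

Lemma dual_linear_bound f b : linear f -> 0 <= b ->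
  (forall x, `|f x| <= b * `|x|) -> dual f /\ 0 <= dual_norm f <= b.
Proof.
move=> flin b0 fb; split; first split=> //.
  move=> x; apply/cvgrPdist_le => eps eps0.
  have b1 : 0 < b + 1 by rewrite ltr_wpDl.
  near=> y; rewrite -linear_formB//.
  apply: le_trans (fb _) _; apply: le_trans (_ : (b + 1) * `|x - y| <= _).
    by rewrite ler_wpM2r// lerDl.
  rewrite mulrC -ler_pdivlMr//; near: y.
  by apply: cvgr_dist_le; [exact: cvg_id|exact: divr_gt0].
have ub : ubound [set `|f x| | x in [set x : Y | `|x| <= 1]] b.
  by move=> _ [x /= x1 <-]; apply: le_trans (fb x) _; rewrite ler_piMr.
have in0 : [set `|f x| | x in [set x : Y | `|x| <= 1]] 0.
  by exists 0; rewrite /= ?normr0// linear_form0// normr0.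
apply/andP; split; last by apply: ge_sup => //; exists 0.
by apply: sup_upper_bound => //; split; [exists 0|exists b].
Unshelve. all: by end_near. Qed.

Lemma dual_bounded f : dual f ->
  exists2 b, 0 < b & forall x, `|f x| <= b * `|x|.
Proof.
move=> [flin fcont]; have f0 := linear_form0 flin.
have := fcont 0 => /cvgrPdist_le /(_ 1 ltr01); rewrite f0 => /nbhs_ballP[d /= d0 dP].
exists (2 / d) => [|x]; first by rewrite divr_gt0.
have [->|x0] := eqVneq x 0; first by rewrite f0 !normr0 mulr0.
have xn : 0 < `|x| by rewrite normr_gt0.
pose k := d / 2 / `|x|; have k0 : 0 < k by rewrite !divr_gt0.
have /= := dP (k *: x) _; rewrite sub0r normrN linear_formZ// normrM (gtr0_norm k0).
rewrite -ler_pdivlMl// mulr1 => h; apply: le_trans (h _) _.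
  rewrite -ball_normE /ball_ /= sub0r normrN normrZ (gtr0_norm k0) /k divfK ?gt_eqF//.
  by rewrite ltr_pdivrMr// ltr_pMr// ltr1n.
by rewrite /k !invf_div mulrC.
Qed.

End DualSpace.

(** * The unit vector basis of X *)

Section Basis.
Variables (R : realType) (p q : R).
Hypothesis (q1 : 1 < q) (qp : q < p).
Local Notation X := (xspace q1 qp).
Local Notation inX := (inX p q rowof).
Local Notation xnorm := (xnorm p q rowof).

Let p1 : 1 < p. Proof. exact: lt_trans qp. Qed.
Let p0 : 0 < p. Proof. exact: lt_trans p1. Qed.

Lemma xspace_embeds : embeds p q rowof X.
Proof.
exists (@xval _ _ _ q1 qp), 1, 1; split=> // u.
by split; [exact: xval_inX|rewrite mul1r lexx].
Qed.

Lemma finite_support_inX m (y : nat -> R) :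
  (forall s, (m <= s)%N -> y s = 0) -> inX y.
Proof.
move=> y0; have -> : y = restr (fun s => (s < m)%N) y.
  by apply/funext => s; rewrite /restr; case: ltnP => [_|/y0->]; rewrite ?mulr1n ?mul0rn.
by exists (\sum_(s < m) `|y s|); exact: head_bounded q1 qp row_le _ _.
Qed.

Lemma unit_inX (i : nat) : inX (fun s => (s == i)%:R).
Proof. by apply: (@finite_support_inX i.+1) => s si; rewrite gtn_eqF. Qed.

Definition xunit (i : nat) : X := mkX q1 qp (unit_inX i).

Lemma xval_sum n (a : nat -> R) (w : nat -> X) s :
  (\sum_(i < n) a i *: w i : X) s = \sum_(i < n) a i * w i s.
Proof.
by elim: n => [|n IH]; rewrite ?big_ord0// !big_ord_recr/= -IH.
Qed.

Lemma xunit_sum n (a : nat -> R) s :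
  (\sum_(i < n) a i *: xunit i : X) s = if (s < n)%N then a s else 0.
Proof.
rewrite xval_sum; case: ltnP => sn; last first.
  by rewrite big1// => i _; rewrite /= gtn_eqF ?mulr0// (leq_trans (ltn_ord i)).
rewrite (bigD1 (Ordinal sn))//= eqxx mulr1 big1 ?addr0// => i /negPf si.
have -> : (s == i :> nat) = false by apply: contraFF si => /eqP si; apply/eqP/val_inj.
by rewrite mulr0.
Qed.

Lemma xunit_cvg (f : nat -> nat) (v : X) : bijective f ->
  converges_to (xunit \o f) ((v : nat -> R) \o f) v.
Proof.
move=> [g fg gf]; apply/cvgrPdist_le => eps eps0.
have [M MP] := xnorm_tail q1 qp (xval_inX v) eps0.
(* From here on every index below [M] has already been enumerated by [f], so the remainder lives on
   the small tail. *)
exists (\max_(s < M) (g s).+1) => // n /= Mn.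
apply: le_trans (MP (fun s => (n <= g s)%N) _); last first.
  move=> s ns; rewrite leqNgt; apply/negP => sM; move: ns; rewrite leqNgt.
  move=> /negP; apply; apply: leq_trans Mn.
  exact: (leq_bigmax (Ordinal sM)).
rewrite xspace_normE le_eqVlt; apply/orP; left; apply/eqP/eq_xnorm => s.
rewrite -[LHS]/(v s - (\sum_(i < n) v (f i) *: xunit (f i) : X) s).
rewrite (xval_sum n (fun i => v (f i)) (fun i => xunit (f i))) /= /restr.
case: ltnP => gs; last first.
  rewrite mulr1n big1 ?subr0// => i _; rewrite -{1}(gf s) (can_eq fg) gtn_eqF ?mulr0//.
  exact: leq_trans (ltn_ord i) gs.
rewrite mulr0n (bigD1 (Ordinal gs))//= gf eqxx mulr1 big1 ?addr0 ?subrr// => i /negPf gi.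
have -> : (s == f i) = false.
  by apply: contraFF gi => /eqP si; apply/eqP/val_inj; rewrite /= si fg.
by rewrite mulr0.
Qed.

Lemma xunit_coord (a : nat -> R) (v : X) : converges_to xunit a v -> a = v.
Proof.
move=> av; apply/funext => s; apply/eqP; rewrite -subr_eq0 -normr_le0.
apply/ler_addgt0Pr => eps eps0; rewrite add0r.
move/cvgrPdist_le: av => /(_ eps eps0) [N _ NP].
have {NP} := NP (maxn N s.+1) (leq_maxl _ _); apply: le_trans.
rewrite distrC; apply: le_trans (xspace_coord (v - _) s).
rewrite -[X in _ <= `|X|]/(v s - (\sum_(i < _) a i *: xunit i : X) s) xunit_sum.
by rewrite leq_max ltnSn orbT.
Qed.

Lemma xunit_schauder : schauder_basis xunit.
Proof.
move=> v; exists (v : nat -> R); split.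
  by apply: (@xunit_cvg id v); exists id.
by move=> a av; rewrite (xunit_coord av).
Qed.

Lemma xunit_unconditional : unconditional_basis xunit.
Proof.
split=> [|a v av f fb]; first exact: xunit_schauder.
by rewrite (xunit_coord av); exact: xunit_cvg.
Qed.

Definition head_part n (x : X) : X := \sum_(i < n) x i *: xunit i.

Lemma head_part_restr n (x : X) :
  ((x - head_part n x : X) : nat -> R) = restr (fun s => (n <= s)%N) x.
Proof.
apply/funext => s; rewrite -[LHS]/(x s - head_part n x s) xunit_sum /restr.
by case: ltnP => _; rewrite ?subrr ?mulr0n// subr0 mulr1n.
Qed.

(* A functional bounded below on unit vectors supported far out would be
   bounded below on averages of almost disjoint blocks, whose norms tend to 0
   because of the upper l^p estimate and 1 < p. *)
Lemma dual_tail (f : X -> R^o) eps : dual f -> 0 < eps ->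
  exists n, forall x, `|f (x - head_part n x)| <= eps * `|x|.
Proof.
move=> fd eps0; have [flin _] := fd; have [b b0 fb] := dual_bounded fd.
have f0 := linear_form0 flin.
apply: contrapT => none.
(* A tail on which [f] is large, divided by the norm of [x] and given the sign that makes [f]
   positive. *)
have /choice[u uP] : forall n, exists u : X,
    [/\ `|u| <= 1, forall s, (s < n)%N -> u s = 0 & eps <= f u].
  move=> n; have [x /negP] : exists x, ~ `|f (x - head_part n x)| <= eps * `|x|.
    by apply: contrapT => h; apply: none; exists n => x; apply: contrapT => hx; apply: h; exists x.
  rewrite -ltNge => fx.
  have x0 : 0 < `|x|.
    rewrite normr_gt0; apply/eqP => x0; move: fx; rewrite x0 normr0 mulr0.
    rewrite (_ : 0 - head_part n 0 = 0) ?f0 ?normr0 ?ltxx//.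
    rewrite /head_part big1 ?subr0// => i _; exact: scale0r.
  pose t := x - head_part n x; pose k := Num.sg (f t) / `|x|.
  exists (k *: t); split.
  - have tx : `|t| <= `|x|.
      rewrite !xspace_normE /t head_part_restr; apply: xnorm_restr => //; exact: xval_inX.
    rewrite normrZ /k normrM normfV normr_id mulrAC ler_pdivrMr// mul1r.
    by apply: le_trans tx; rewrite normr_sg ler_piMl//; case: eqP.
  - move=> s sn; rewrite -[LHS]/(k * (t : nat -> R) s) /t head_part_restr /restr.
    by rewrite leqNgt sn mulr0.
  - rewrite linear_formZ// /k mulrAC -normrEsg ler_pdivlMr//; exact: ltW.
have ub n : bounded_by p q rowof (u n) 1.
  have [u1 _ _] := uP n => m K c mKc; apply: le_trans u1.
  by apply: colnorm_xnorm mKc; exact: xval_inX.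
have [sigma [z [L [v [D dec]]]]] := block_decomposition_exists q1 qp row_le ub.
have [[zX _ D0] [L_mono L_ge] v_supp vP _] := dec.
(* [u n] vanishes below [n] and the block [v j] starts at [L j >= j], so at a fixed [s] only the
   error separates [z s] from 0. *)
have z0 s : z s = 0.
  apply/eqP; rewrite -normr_le0; apply/ler_addgt0Pr => d d0; rewrite add0r.
  have [m h] : exists m, 2 / d <= m%:R.
    by exists (Num.bound (2 / d)); apply/ltW/archi_boundP; rewrite divr_ge0// ltW.
  pose j := maxn m s.+1.
  have [_ us _] := uP (sigma j); have [_ _ errb] := vP j.
  have sj : (s < j)%N by rewrite leq_max ltnSn orbT.
  have vjs : v j s = 0.
    have [//|/v_supp/andP[Ljs _]] := eqVneq (v j s) 0.
    by have := leq_trans (leq_trans sj (L_ge j)) Ljs; rewrite ltnn.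
  have := xnorm_coord q1 qp row_le s (bounded_inX errb).
  rewrite vjs us ?(leq_trans sj (decomp_ge dec j))// sub0r subr0 normrN => /le_trans; apply.
  apply: le_trans (bounded_xnorm errb) _.
  rewrite exprVn ler_pdivrMr ?exprn_gt0// -ler_pdivrMl// mulrC (le_trans h)//.
  by rewrite -natrX ler_nat (leq_trans (leq_maxl m s.+1))// ltnW// ltn_expl.
have Nz : xnorm z = 0.
  by rewrite (eq_xnorm p q rowof (z0 : z =1 fun=> 0)) xnorm0//; exact: row_le.
have D40 : 0 < D + 4 by rewrite ltr_wpDl.
(* With this bound on the average of the coefficients, |f av| <= b |av| <= eps / 2, whereas [f av]
   is at least [eps]. *)
have e0 : 0 < eps / 2 / b / (D + 4) by rewrite !divr_gt0.
have [K /(_ K (leqnn K)) [K0 small]] := pn_average_small p1 e0.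
have := decomp_upper q1 qp row_le dec K 0 (fun=> K%:R^-1).
rewrite Nz mulr0 add0r => avg_small.
pose av : X := \sum_(i < K) (K%:R^-1 : R) *: u (sigma i).
have avE : xnorm (comb K (fun=> K%:R^-1) (fun i => u (sigma (0 + i)%N))) = `|av|.
  rewrite xspace_normE; apply: eq_xnorm => s.
  by rewrite /av (xval_sum K (fun=> K%:R^-1) (fun i => u (sigma i))).
have fav : eps <= f av.
  have -> : f av = \sum_(i < K) K%:R^-1 * f (u (sigma i)).
    exact: (linear_form_sum K (fun=> K%:R^-1) (fun i => u (sigma i)) flin).
  have -> : eps = \sum_(i < K) K%:R^-1 * eps by rewrite -mulr_suml sum_average// mul1r.
  apply: ler_sum => i _.
  by apply: ler_wpM2l; [rewrite invr_ge0 ler0n|case: (uP (sigma i))].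
have : eps <= eps / 2.
  apply: le_trans fav _; apply: le_trans (ler_norm _) _; apply: le_trans (fb _) _.
  rewrite mulrC -ler_pdivlMr// -avE; apply: le_trans avg_small _.
  by rewrite mulrC -ler_pdivlMr.
by rewrite leNgt ltr_pdivrMr// ltr_pMr// ltr1n.
Qed.

(** [Phi] is represented by its values [y] on the coordinate functionals. Norming functionals are
    finite combinations of coordinates, so [y] lies in X; by [dual_tail] every functional is close
    to such combinations. *)
Lemma xspace_reflexive : reflexive_space X.
Proof.
move=> Phi [Plin [C PC]].
(* The constant [C] carries no sign, hence its absolute value. *)
have Pbound (f : X -> R^o) b : linear f -> 0 <= b -> (forall x, `|f x| <= b * `|x|) ->
    `|Phi f| <= `|C| * b.
  move=> flin b0 fb; have [fd /andP[f0 fn]] := dual_linear_bound flin b0 fb.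
  apply: le_trans (PC f fd) _; apply: le_trans (_ : `|C| * dual_norm f <= _).
    by rewrite ler_wpM2r// ler_norm.
  by rewrite ler_wpM2l.
pose coord s : X -> R^o := fun x => x s.
have comb_dual n (g : nat -> R) : dual (fun x : X => \sum_(s < n) g s * x s : R^o).
  have b0 : 0 <= \sum_(s < n) `|g s| by apply: sumr_ge0 => s _; exact: normr_ge0.
  have bP (x : X) : `|\sum_(s < n) g s * x s| <= (\sum_(s < n) `|g s|) * `|x|.
    rewrite mulr_suml.
    apply: le_trans (ler_norm_sum _ _ _) _; apply: ler_sum => s _.
    by rewrite normrM ler_wpM2l// xspace_coord.
  apply: (dual_linear_bound _ b0 bP).1 => a u v.
  rewrite /GRing.scale/= mulr_sumr -big_split/=; apply: eq_bigr => s _.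
  by rewrite mulrDr mulrCA.
have coord_dual s : dual (coord s).
  have := comb_dual s.+1 (fun i => (i == s)%:R); congr dual; apply/funext => x.
  rewrite big_ord_recr/= eqxx mul1r big1 ?add0r// => i _.
  by rewrite ltn_eqF// mul0r.
pose y s := Phi (coord s).
have Psum n (g : nat -> R) :
    Phi (fun x : X => \sum_(s < n) g s * x s) = \sum_(s < n) g s * y s.
  elim: n => [|n IH].
    (* Linearity of [Phi] is given only as one combined identity; the zero functional is brought
       into its form. *)
    have -> : (fun x : X => \sum_(s < 0) g s * x s) = fun x => - 1 * coord 0%N x + coord 0%N x.
      by apply/funext => x; rewrite big_ord0 mulN1r addNr.
    by rewrite Plin// mulN1r addNr big_ord0.
  rewrite big_ord_recr/= -IH addrC -(Plin _ _ _ (coord_dual n) (comb_dual n g)).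
  by congr Phi; apply/funext => x; rewrite big_ord_recr/= addrC.
have yX : inX y.
  exists `|C| => n K c nKc.
  have [g [gP <-]] := colnorm_norming rowof q1 qp n K c y.
  rewrite -Psum -[leRHS]mulr1; apply: le_trans (ler_norm _) _; apply: Pbound => //.
    by have [] := comb_dual n g.
  move=> x; rewrite mul1r; apply: le_trans (gP x) _.
  exact: colnorm_xnorm (xval_inX x) nKc.
exists (mkX q1 qp yX) => f fd; have [flin _] := fd.
set x0 := mkX q1 qp yX.
apply/eqP; rewrite -subr_eq0 -normr_le0; apply/ler_addgt0Pr => eps eps0; rewrite add0r.
have A0 : 0 < `|C| + `|x0| + 1 by rewrite ltr_wpDl// addr_ge0.
have [n nP] := dual_tail fd (divr_gt0 eps0 A0).
have fB u v : f (u - v) = f u - f v by exact: linear_formB.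
have fhead x : f (head_part n x) = \sum_(s < n) f (xunit s) * x s.
  rewrite /head_part linear_form_sum//; apply: eq_bigr => s _; exact: mulrC.
(* On the head of [f], [Phi] agrees with evaluation at [x0] by [Psum]; only the small tail [ft] has
   to be estimated. *)
pose ft : X -> R^o := fun x => f (x - head_part n x).
have ftlin : linear ft.
  move=> a u v; rewrite /ft !fB !fhead flin.
  have -> : \sum_(s < n) f (xunit s) * (a *: u + v : X) s =
      a * (\sum_(s < n) f (xunit s) * u s) + \sum_(s < n) f (xunit s) * v s.
    rewrite mulr_sumr -big_split/=; apply: eq_bigr => s _.
    by rewrite -[LHS]/(f (xunit s) * (a * u s + v s)) mulrDr mulrCA.
  by rewrite /GRing.scale/=; ring.
have e1 := ltW (divr_gt0 eps0 A0).
have ftd := (dual_linear_bound ftlin e1 nP).1.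
have PfE : Phi f = Phi ft + f (head_part n x0).
  rewrite fhead -(Psum n (fun s => f (xunit s))) -[Phi ft]mul1r.
  rewrite -(Plin 1 _ _ ftd (comb_dual n (fun s => f (xunit s)))); congr Phi; apply/funext => x.
  by rewrite /ft fB fhead mul1r subrK.
have -> : Phi f - f x0 = Phi ft - f (x0 - head_part n x0) by rewrite PfE fB opprB addrA.
apply: le_trans (ler_normB _ _) _.
apply: le_trans (lerD (Pbound _ _ ftlin e1 nP) (nP x0)) _.
rewrite mulrC -mulrDr mulrAC ler_pdivrMr// ler_pM2l// lerDl//.
Qed.

End Basis.

(** * The spreading model of order k *)

Section KSubsets.
Implicit Types s t : {fset nat}.

Lemma size_elts s : size (elts s) = #|` s|.
Proof. by rewrite /elts size_sort. Qed.

Lemma mem_elts s x : (x \in elts s) = (x \in s).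
Proof. by rewrite /elts mem_sort. Qed.

Lemma elts_inj s t : elts s = elts t -> s = t.
Proof. by move=> st; apply/fsetP => x; rewrite -!mem_elts st. Qed.

Lemma elts_sorted s : sorted ltn (elts s).
Proof.
rewrite ltn_sorted_uniq_leq /elts sort_uniq fset_uniq/=.
exact/sort_sorted/leq_total.
Qed.

Lemma elts_seq (l : seq nat) : sorted ltn l -> elts [fset x in l]%fset = l.
Proof.
rewrite ltn_sorted_uniq_leq => /andP[lu ls].
apply: (sorted_eq leq_trans anti_leq) => //; first exact/sort_sorted/leq_total.
rewrite /elts perm_sort; apply: uniq_perm => //; first exact: fset_uniq.
by move=> x; rewrite in_fset.
Qed.

Lemma init_seg_card t s : init_seg t s -> (#|` t| <= #|` s|)%N.
Proof. by rewrite -!size_elts => /prefixP[u ->]; rewrite size_cat leq_addr. Qed.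

Lemma proper_init_seg_card t s : proper_init_seg t s -> (#|` t| < #|` s|)%N.
Proof.
move=> /andP[ts /prefixP[u su]]; rewrite -!size_elts su size_cat.
case: u su => [|x u] su; last by rewrite -addSnnS leq_addr.
by case/eqP: ts; apply: elts_inj; rewrite su cats0.
Qed.

Lemma init_seg_extend t j : exists2 s, init_seg t s & #|` s| = (#|` t| + j)%N.
Proof.
(* The set is prolonged by [j] consecutive integers past its maximum. *)
pose m := (\max_(x <- elts t) x).+1.
have l_sorted : sorted ltn (elts t ++ iota m j).
  rewrite sorted_pairwise; last exact: ltn_trans.
  rewrite pairwise_cat -!sorted_pairwise; try exact: ltn_trans.
  rewrite elts_sorted iota_ltn_sorted !andbT; apply/allrelP => x y xt.
  rewrite mem_iota => /andP[my _]; apply: leq_trans my; rewrite ltnS.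
  exact: leq_bigmax_seq.
exists [fset x in elts t ++ iota m j]%fset.
  by rewrite /init_seg elts_seq// prefix_prefix.
by rewrite -size_elts elts_seq// size_cat size_iota size_elts.
Qed.

Definition ksubsets (k : nat) : set {fset nat} := [set s | #|` s| = k].

Lemma init_closure_ksubsets k : init_closure (ksubsets k) = [set s | (#|` s| <= k)%N].
Proof.
apply/seteqP; split=> [t [s <-]|t /= tk]; first exact: init_seg_card.
have [s ts sk] := init_seg_extend t (k - #|` t|).
by exists s => //; rewrite /ksubsets /= sk subnKC.
Qed.

Lemma cantor_near (f : cantor_space) N :
  nbhs f [set g : cantor_space | forall n, (n < N)%N -> g n = f n].
Proof.
elim: N => [|N IH]; first by apply: filterS filterT => g _ n.
have h : nbhs f [set g : cantor_space | g N = f N].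
  exact: (@proj_continuous nat (fun=> bool) N f [set f N] (discrete_set1 (f N))).
apply: filterS (filterI IH h) => g [/= a b] n.
by rewrite ltnS leq_eqVlt => /predU1P[->//|]; exact: a.
Qed.

(** A limit of characteristic functions of sets with at most [k] elements has at most [k] ones on
    every initial interval, so it is the characteristic function of such a set. *)
Lemma ksubsets_compact k : compact_family (init_closure (ksubsets k)).
Proof.
rewrite init_closure_ksubsets => f fcl.
have cnt N : (count f (iota 0 N) <= k)%N.
  have [_ [[s /= sk <-] sf]] := fcl _ (cantor_near f N).
  rewrite -size_filter; apply: leq_trans sk; rewrite -size_elts.
  apply: uniq_leq_size; first by rewrite filter_uniq ?iota_uniq.
  move=> n; rewrite mem_filter mem_iota add0n mem_elts => /andP[fn nN].
  by have := sf n nN; rewrite /= fn.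
have ex : exists c, `[< exists N, count f (iota 0 N) = c >].
  by exists 0%N; apply/asboolP; exists 0%N.
have ub c : `[< exists N, count f (iota 0 N) = c >] -> (c <= k)%N.
  by move=> /asboolP[N <-].
(* Once the number of ones below [N] is maximal, no further one occurs. *)
case: (ex_maxnP ex ub) => c /asboolP[N Nc] cmax.
have f0 n : (N <= n)%N -> f n = false.
  move=> Nn; apply/negP => fn.
  have := cmax (count f (iota 0 n.+1)) (introT (asboolP _) (ex_intro _ n.+1 erefl)).
  rewrite -addn1 iotaD count_cat add0n /= fn addn0 -(subnKC Nn) iotaD count_cat Nc.
  by rewrite -addnA addn1 addnS ltnNge leq_addr.
exists [fset n in [seq n <- iota 0 N | f n]]%fset.
  rewrite /= -size_elts elts_seq ?size_filter//.
  by apply: sorted_filter; [exact: ltn_trans|exact: iota_ltn_sorted].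
apply/funext => n; rewrite in_fset mem_filter mem_iota add0n.
by case: ltnP => [_|/f0 ->]; rewrite ?andbT// andbF.
Qed.

Lemma ksubsets_regular_thin k : regular_thin (ksubsets k).
Proof.
split.
  move=> s t sk tk; apply/negP => /proper_init_seg_card.
  by rewrite (sk : #|` s| = k) (tk : #|` t| = k) ltnn.
split; last exact: ksubsets_compact.
  rewrite init_closure_ksubsets => s t /= sk ts.
  exact: leq_trans (fsubset_leq_card ts) sk.
by rewrite init_closure_ksubsets => s t /= sk ->.
Qed.

Lemma ksubsets_order k : has_order (ksubsets k) k.
Proof.
split; first by rewrite init_closure_ksubsets.
(* The rank of a set is the number of elements still to be added. *)
exists (fun s => (k - #|` s|)%N); last by rewrite cardfs0 subn0.
rewrite init_closure_ksubsets => s /= sk; split=> [_ [t /= [tk st] <-]|b bub].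
  by rewrite leEnat ltn_sub2l//; [exact: leq_trans (proper_init_seg_card st) tk|exact: proper_init_seg_card].
rewrite leEnat; have [ks|ks] := leqP k #|` s|; first by rewrite (eqP ks).
have [t st tcard] := init_seg_extend s 1; rewrite addn1 in tcard.
have := bub (k - #|` t|).+1; rewrite leEnat tcard -subSn// subSS; apply.
exists t; rewrite /= ?tcard ?subnSK// ?subSn//; split=> //.
rewrite /proper_init_seg st andbT; apply/eqP => e.
by have := tcard; rewrite -e => /eqP; rewrite ltn_eqF.
Qed.

End KSubsets.

Definition pair_index (m n : nat) : nat := (2 ^ m * n.*2.+1).-1.

Lemma pair_indexS m n : (pair_index m n).+1 = (2 ^ m * n.*2.+1)%N.
Proof. by rewrite prednK// muln_gt0 expn_gt0. Qed.

Lemma row_pair_index m n : rowof (pair_index m n) = m.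
Proof.
rewrite /rowof pair_indexS lognM ?expn_gt0// pfactorK//.
by rewrite (_ : logn 2 n.*2.+1 = 0%N) ?addn0//; exact: (row_double n).
Qed.

Lemma pair_index_ge m n : (n <= pair_index m n)%N.
Proof.
rewrite -ltnS pair_indexS; apply: leq_trans (_ : n.*2.+1 <= _)%N.
  by rewrite ltnS -addnn leq_addr.
by rewrite leq_pmull// expn_gt0.
Qed.

(** * The l^q spreading model in X *)

Section OrderK.
Variables (R : realType) (p q : R).
Hypothesis (q1 : 1 < q) (qp : q < p).
Local Notation X := (xspace q1 qp).

Let q0 : 0 < q. Proof. exact: lt_trans q1. Qed.

Lemma sum_indicator_le n (h : 'I_n -> nat) (c : R) i : injective h -> 0 <= c ->
  \sum_(j < n) c *+ (h j == i) <= c.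
Proof.
move=> hinj c0; have [j /eqP hj|none] := pickP (fun j => h j == i).
  rewrite (bigD1 j)//= hj eqxx mulr1n big1 ?addr0// => k kj.
  by rewrite -hj (inj_eq hinj) (negPf kj).
by rewrite big1// => j _; rewrite none.
Qed.

Lemma sum_inj_le n m (h : 'I_n -> nat) (F : nat -> R) : injective h ->
  (forall i, 0 <= F i) -> (forall j, (h j < m)%N) ->
  \sum_(j < n) F (h j) <= \sum_(i < m) F i.
Proof.
move=> hinj F0 hm.
apply: le_trans (_ : \sum_(i < m) \sum_(j < n) F i *+ (h j == i) <= _); last first.
  by apply: ler_sum => i _; exact: sum_indicator_le.
rewrite exchange_big; apply: ler_sum => j _.
by rewrite (bigD1 (Ordinal (hm j)))//= eqxx lerDl sumr_ge0// => i _; exact: mulrn_wge0.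
Qed.

(** The rows are distinct, so every row norm is a single coefficient, and the set is admissible, so
    one colour already gives the l^q norm. It is also the largest possible value, by
    [colnorm_pn]. *)
Lemma norm_admissible_family J (a : nat -> R) (h : 'I_J -> nat) :
  injective (fun j => rowof (h j)) -> (forall i j, (rowof (h i) <= h j)%N) ->
  `|\sum_(j < J) a j *: xunit q1 qp (h j)| = pn q J a.
Proof.
move=> rinj rh; have hinj : injective h by move=> i j /(congr1 rowof)/rinj.
set y := \sum_(j < J) _.
have yE s : y s = \sum_(j < J) a j * (s == h j)%:R.
  by rewrite /y (big_morph (fun u : X => u s) (id1 := 0) (op1 := +%R)).
have yh j : y (h j) = a j.
  rewrite yE (bigD1 j)//= eqxx mulr1 big1 ?addr0// => i ij.
  by rewrite (inj_eq hinj) eq_sym (negPf ij) mulr0.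
apply/eqP; rewrite eq_le; apply/andP; split.
  apply: (@bounded_xnorm _ p q rowof) => n K c _.
  apply: le_trans (colnorm_pn q1 qp row_le _ _ _ _) _; rewrite pn_le_pow ?pn_ge0// pn_pow//.
  apply: le_trans (_ : \sum_(s < n) \sum_(j < J) `|a j| `^ q *+ (h j == s) <= _).
    apply: ler_sum => s _; have [j /eqP hj|none] := pickP (fun j => h j == s).
      rewrite -hj yh (bigD1 j)//= eqxx mulr1n ler_wpDr//.
      by apply: sumr_ge0 => i _; apply: mulrn_wge0; exact: powR_ge0.
    rewrite yE big1 ?normr0 ?powR0 ?gt_eqF// => [|j _].
      by apply: sumr_ge0 => i _; apply: mulrn_wge0; exact: powR_ge0.
    by rewrite eq_sym none mulr0.
  rewrite exchange_big; apply: ler_sum => j _.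
  apply: le_trans (_ : \sum_(s < n) `|a j| `^ q *+ ((s : nat) == h j) <= _).
    by apply: ler_sum => s _; rewrite eq_sym.
  by apply: sum_indicator_le; [exact: val_inj|exact: powR_ge0].
pose n := (\max_(j < J) h j).+1.
have hn j : (h j < n)%N by rewrite ltnS; exact: (leq_bigmax j).
pose A : pred nat := fun s => [exists j, h j == s].
apply: le_trans (@class_le_xnorm _ p q rowof q1 qp n A y (xval_inX y) _); last first.
  by move=> s s' _ _ /existsP[i /eqP <-] /existsP[j /eqP <-].
rewrite pn_le_pow ?pn_ge0// pn_pow//.
have rn j : (rowof (h j) < n)%N by apply: leq_ltn_trans (row_le _) (hn j).
apply: le_trans (sum_inj_le (F := fun i => `|rownorm p rowof n (restr A y) i| `^ q) rinj _ rn).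
  apply: ler_sum => j _; apply: ler_powRl => //; first exact: ltW.
  rewrite [leRHS]ger0_norm ?pn_ge0//.
  have := @rownorm_coord _ p q rowof q1 qp n (restr A y) (h j) (hn j); rewrite /restr yh.
  by have -> : A (h j) by apply/existsP; exists j.
by move=> i; exact: powR_ge0.
Qed.

(** Polynomials serve as a concrete space with a Hamel basis, the monomials; the l^q norm of the
    coefficients makes this basis isometric to that of l^q. *)
Definition poly_norm (P : {poly R}) : R := pn q (size P) (fun i => P`_i).

Lemma poly_norm_ge_size (P : {poly R}) n : (size P <= n)%N ->
  poly_norm P = pn q n (fun i => P`_i).
Proof.
move=> Pn; rewrite /poly_norm !pnE; congr (_ `^ _).
rewrite (big_ord_widen _ (fun i => `|P`_i| `^ q) Pn) big_mkcond/=.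
apply: eq_bigr => i _; case: ltnP => // Pi.
by rewrite nth_default// normr0 powR0// gt_eqF.
Qed.

Lemma poly_norm_seminorm : is_seminorm poly_norm.
Proof.
split=> [u v|a u].
  pose n := maxn (size u) (size v).
  rewrite (@poly_norm_ge_size (u + v) n) ?size_polyD//.
  rewrite (@poly_norm_ge_size u n) ?leq_maxl// (@poly_norm_ge_size v n) ?leq_maxr//.
  by under [X in pn q n X]eq_fun do rewrite coefD; exact: ler_pnD.
rewrite (@poly_norm_ge_size (a *: u) (size u)) ?size_scale_leq// -pnZ//.
by apply: eq_pn => i _; rewrite coefZ.
Qed.

Lemma coef_sumX n (a : nat -> R) i :
  (\sum_(j < n) a j *: 'X^j : {poly R})`_i = if (i < n)%N then a i else 0.
Proof. by rewrite -(poly_def n a) coef_poly. Qed.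

Lemma poly_norm_sum n (a : nat -> R) : poly_norm (\sum_(j < n) a j *: 'X^j) = pn q n a.
Proof.
rewrite (@poly_norm_ge_size _ n).
  by apply: eq_pn => i ni; rewrite coef_sumX ni.
by rewrite -(poly_def n a) size_poly.
Qed.

Lemma monomials_hamel : hamel_basis (fun i => 'X^i : {poly R}).
Proof.
split=> [n a a0 i ni|].
  by have := coef_sumX n a i; rewrite a0 coef0 ni.
apply/seteqP; split=> // P _; exists (size P), (fun i => P`_i).
by rewrite -[LHS]coefK poly_def.
Qed.

Lemma xspace_sm_of_order k : (1 < k)%N -> admits_ell_sm_of_order X q k.
Proof.
move=> k1; exists (ksubsets k), id.
(* Only the first two elements of [s] matter. In a plegma tuple the first elements, which are the
   rows, are distinct, and each of them is below all second elements, which gives admissibility. *)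
exists (fun s => xunit q1 qp (pair_index (elt s 0) (elt s 1))).
exists {poly R}, poly_norm, (fun i => 'X^i : {poly R}); split=> //.
- by split; [exact: ksubsets_regular_thin|exact: ksubsets_order].
- by split; [exact: poly_norm_seminorm|exact: monomials_hamel].
(* The two norms agree exactly, so any positive null sequence will do. *)
- exists (fun n => n.+1%:R^-1).
    split=> [n|]; first by rewrite invr_gt0 ltr0n.
    exact: cvg_harmonic.
  move=> j l s a _ sF [_ pl1 pl2] _ _.
  have sk i : #|` s i| = k by have [] := sF i.
  have m0 i i' : (0 < minn #|` s i| #|` s i'|)%N by rewrite !sk minnn (ltn_trans _ k1).
  have m1 i i' : (1 < minn #|` s i| #|` s i'|)%N by rewrite !sk minnn.
  (* The coefficients are extended from ordinals to [nat], as [pn] expects. *)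
  pose b (i : nat) := a (inord i).
  pose h i := pair_index (elt (s i) 0) (elt (s i) 1).
  have -> : \sum_(i < j.+1) a i *: 'X^i = \sum_(i < j.+1) b i *: 'X^i :> {poly R}.
    by apply: eq_bigr => i _; rewrite /b inord_val.
  rewrite poly_norm_sum.
  have -> : \sum_(i < j.+1) a i *: xunit q1 qp (h i) = \sum_(i < j.+1) b i *: xunit q1 qp (h i).
    by apply: eq_bigr => i _; rewrite /b inord_val.
  rewrite norm_admissible_family ?subrr ?normr0 ?invr_ge0//.
    move=> i i'; rewrite !row_pair_index => e; apply/val_inj.
    case: (ltngtP i i') => // h'.
      by have := pl1 i i' 0%N h' (m0 _ _); rewrite e ltnn.
    by have := pl1 i' i 0%N h' (m0 _ _); rewrite e ltnn.
  move=> i i'; rewrite row_pair_index.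
  exact: leq_trans (ltnW (pl2 i i' 0%N (m1 _ _))) (pair_index_ge _ _).
- exists 1, 1; split=> // n a.
  by rewrite poly_norm_sum ell_norm_sum// !mul1r lexx.
Qed.

End OrderK.

Theorem theorem0p32 (R : realType) (p q : R) (k : nat) :
  1 < q -> q < p -> (1 < k)%N ->
  exists X : completeNormedModType R,
    [/\ reflexive_space X,
        exists b : nat -> X, unconditional_basis b,
        admits_ell_sm_of_order X q k
      & forall (l : nat) (E : completeNormedModType R) (e : nat -> E),
          iterated_spreading_model l X e ->
          equivalent_to_ell (@Num.norm R E) e 1 \/
          equivalent_to_ell (@Num.norm R E) e p].
Proof.
move=> q1 qp k1; exists (xspace q1 qp : completeNormedModType R); split.
- exact: xspace_reflexive.
- by exists (xunit q1 qp); exact: xunit_unconditional.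
- exact: xspace_sm_of_order.
- move=> l E e h; right.
  exact: (iterated_spreading_model_lp q1 qp (xspace_embeds q1 qp) h).
Qed.
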